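(* Let $\pi:M(c)\to N$ be an anti-invariant submersion from a quaternionic space form $(M(c),g_M)$ onto a Riemannian manifold $(N,g_N)$, and let $\{U_1,\dots,U_r\}$, $\{X_1,\dots,X_\ell\}$ be local orthonormal frames of $\mathcal V$ and $\mathcal H$. Then $$\frac c4\Big((\ell+r)(\ell+r-1)+\sum_{\alpha=1}^3\sum_{i=1}^\ell\big(6\|B_{J_\alpha}X_i\|^2+3\|C_{J_\alpha}X_i\|^2\big)\Big)$$ $$\le\ \hat\tau+\tau^*+r(r-1)\|H\|^2+3\|\mathcal A^{\mathcal V}\|^2-2\delta(N)+2\|\mathcal T^{\mathcal V}\|^2-2\|\mathcal A^{\mathcal H}\|^2 .$$ Equality holds for all $p\in M$ if and only if both of the following hold: (1) $\pi$ is a Riemannian submersion with totally umbilical fibers; (2) $\mathcal T_{ij}=0$ for all $i\ne j$ in $\{1,\dots,r\}$, where $\mathcal T_{ij}=\mathcal T_{U_i}U_j$.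
   Context: An almost quaternionic Hermitian manifold $(M,E,g_M)$ is a $4m$-dimensional Riemannian manifold with a rank 3 subbundle $E\subset \mathrm{End}(TM)$ having, near each point, a local basis $\{J_1,J_2,J_3\}$ of sections with $J_\alpha^2=-\mathrm{id}$, $J_\alpha J_{\alpha+1}=-J_{\alpha+1}J_\alpha=J_{\alpha+2}$ (indices mod 3) and $g_M(J_\alpha X,J_\alpha Y)=g_M(X,Y)$. It is quaternionic Kähler if there are local 1-forms $\omega_1,\omega_2,\omega_3$ with $\nabla_XJ_\alpha=\omega_{\alpha+2}(X)J_{\alpha+1}-\omega_{\alpha+1}(X)J_{\alpha+2}$, $\nabla$ the Levi-Civita connection. A quaternionic space form $M(c)$ ($c\in\mathbb R$) is a quaternionic Kähler manifold whose curvature tensor is $$R(X,Y)Z=\tfrac c4\Big\{g_M(Y,Z)X-g_M(X,Z)Y+\sum_{\alpha=1}^3\big(g_M(J_\alpha Y,Z)J_\alpha X-g_M(J_\alpha X,Z)J_\alpha Y+2g_M(J_\alpha Y,X)J_\alpha Z\big)\Big\}.$$ A Riemannian submersion $\pi:(M,g_M)\to(N,g_N)$ ($\dim M>\dim N$) is a smooth surjective map of maximal rank whose differential restricted to $(\ker\pi_* )^\perp$ is a linear isometry. Write $\mathcal V=\ker\pi_*$ (vertical), $\mathcal H=(\ker\pi_* )^\perp$ (horizontal), $r=\dim\mathcal V$, $\ell=\dim\mathcal H$, and use the same letters for the orthogonal projections. The submersion $\pi$ is anti-invariant if $J_\alpha(\ker\pi_* )\subset(\ker\pi_* )^\perp$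 for $\alpha=1,2,3$. For horizontal $X$ write $J_\alpha X=B_{J_\alpha}X+C_{J_\alpha}X$ with $B_{J_\alpha}X$ vertical and $C_{J_\alpha}X$ horizontal; $\|B_{J_\alpha}X_i\|^2=\sum_{k=1}^r g_M(B_{J_\alpha}X_i,U_k)^2$, $\|C_{J_\alpha}X_i\|^2=\sum_{j=1}^\ell g_M(C_{J_\alpha}X_i,X_j)^2$. O'Neill tensors: $\mathcal A_EF=\mathcal H\nabla_{\mathcal HE}\mathcal VF+\mathcal V\nabla_{\mathcal HE}\mathcal HF$, $\mathcal T_EF=\mathcal H\nabla_{\mathcal VE}\mathcal VF+\mathcal V\nabla_{\mathcal VE}\mathcal HF$. Notation: $\|\mathcal T^{\mathcal V}\|^2=\sum_{i=1}^\ell\sum_{k=1}^r\|\mathcal T_{U_k}X_i\|^2$, $\|\mathcal A^{\mathcal V}\|^2=\sum_{i,j=1}^\ell\|\mathcal A_{X_i}X_j\|^2$, $\|\mathcal A^{\mathcal H}\|^2=\sum_{i=1}^\ell\sum_{k=1}^r\|\mathcal A_{X_i}U_k\|^2$. Put $N=\sum_{j=1}^r\mathcal T_{U_j}U_j$ (a horizontal vector field, not to be confused with the target manifold), $H=\frac1rN$ (mean curvature of the fibers), and $\delta(N)=\sum_{i=1}^\ell g_M(\nabla_{X_i}N,X_i)=\sum_{i=1}^\ell\sum_{k=1}^r g_M((\nabla_{X_i}\mathcal T)(U_k,U_k),X_i)$. The fibers are totally umbilical if $\mathcal T_UV=g_M(U,V)H$ for all vertical $U,V$. Curvature convention: $R(X,Y,Z,W)=g_M(R(X,Y)Z,W)$;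 $\hat R$ is the curvature tensor of the vertical distribution (fibers) and $R^*$ that of the horizontal distribution (horizontal lift of the curvature tensor $R'$ of the target: $\pi_*(R^*(X,Y)Z)=R'(\pi_*X,\pi_*Y)\pi_*Z$). They satisfy, for vertical $U,V,F,W$ and horizontal $X,Y,Z,Z'$, $$R(U,V,F,W)=\hat R(U,V,F,W)+g_M(\mathcal T_UW,\mathcal T_VF)-g_M(\mathcal T_VW,\mathcal T_UF),$$ $$R(X,Y,Z,Z')=R^*(X,Y,Z,Z')-2g_M(\mathcal A_XY,\mathcal A_ZZ')+g_M(\mathcal A_YZ,\mathcal A_XZ')-g_M(\mathcal A_XZ,\mathcal A_YZ'),$$ $$R(X,V,Y,W)=g_M((\nabla_X\mathcal T)(V,W),Y)+g_M((\nabla_V\mathcal A)(X,Y),W)-g_M(\mathcal T_VX,\mathcal T_WY)+g_M(\mathcal A_YW,\mathcal A_XV);$$ the sign of the curvature tensors is the one for which these hold, i.e. $R(X,Y)Z=\nabla_{[X,Y]}Z-\nabla_X\nabla_YZ+\nabla_Y\nabla_XZ$. Finally $\hat\tau=\sum_{i,j=1}^r\hat R(U_j,U_i,U_i,U_j)$ and $\tau^*=\sum_{i,j=1}^\ell R^*(X_i,X_j,X_j,X_i)$. *)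

(* Defs.v *)
From HB Require Import structures.
From mathcomp Require Import all_boot all_order all_algebra.
From mathcomp Require Import all_classical all_reals all_analysis.

Set Implicit Arguments.
Unset Strict Implicit.
Unset Printing Implicit Defensive.
Import Order.TTheory GRing.Theory Num.Theory.
Import numFieldNormedType.Exports.
Local Open Scope classical_set_scope.
Local Open Scope ring_scope.

(* Throughout, a locally defined object (function, vector field, tensor) is   *)
(* represented by a total function together with an open set on which it is   *)
(* meaningful; its values elsewhere are irrelevant.                           *)

(** * Smooth manifolds *)

(* [Ck k D f]: the partial derivatives of [f] of order < k exist and are      *)
(* differentiable on the open set D, those of order k are continuous on D.    *)
Fixpoint Ck (R : realType) (n k : nat) (D : set 'rV[R]_n)
    (f : 'rV[R]_n -> R) : Prop :=
  if k is k'.+1 then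
    (forall x, D x -> differentiable f x) /\
    (forall i, Ck k' D (fun x => 'D_(delta_mx ord0 i) f x))
  else forall x, D x -> {for x, continuous f}.

Definition Cinf (R : realType) (n : nat) (D : set 'rV[R]_n)
    (f : 'rV[R]_n -> R) : Prop := forall k, Ck k D f.

Record chart (R : realType) (n : nat) (M : topologicalType) := Chart {
  cdom : set M;
  cmap : M -> 'rV[R]_n;
  cinv : 'rV[R]_n -> M }.

Definition chart_ok (R : realType) (n : nat) (M : topologicalType)
    (c : chart R n M) : Prop :=
  [/\ open (cdom c), open (cmap c @` cdom c),
      forall p, cdom c p -> cinv c (cmap c p) = p,
      forall p, cdom c p -> {for p, continuous (cmap c)}
    & forall p, cdom c p -> {for cmap c p, continuous (cinv c)}].

Definition charts_compatible (R : realType) (n : nat) (M : topologicalType)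
    (c c' : chart R n M) : Prop :=
  forall j, Cinf (cmap c @` (cdom c `&` cdom c'))
                 (fun x => cmap c' (cinv c x) ord0 j).

Record manifold (R : realType) (n : nat) := Manifold {
  mcarrier :> topologicalType;
  matlas : set (chart R n mcarrier);
  mhausdorff : hausdorff_space mcarrier;
  msecond_countable : @second_countable mcarrier;
  mcharts : forall c, matlas c -> chart_ok c;
  mcover : forall p, exists2 c, matlas c & cdom c p;
  mcompat : forall c c', matlas c -> matlas c' -> charts_compatible c c' }.

Section Manifold.
Context {R : realType} {n : nat} {M : manifold R n}.

Definition smooth_on (W : set M) (f : M -> R) : Prop :=
  forall c, matlas c -> Cinf (cmap c @` (cdom c `&` W)) (f \o cinv c).

Definition smooth_at (p : M) (f : M -> R) : Prop :=
  exists W, [/\ open W, W p & smooth_on W f].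

(** ** Tangent vectors *)

(* A tangent vector at p is an operator on the functions smooth near p, namely *)
(* a directional derivative at p in a chart. Its value on the functions that  *)
(* are not smooth near p is normalised to 0, so that equality of tangent      *)
(* vectors is equality of operators.                                          *)
Definition tvec : lmodType R := ((M -> R) -> R^o).

Definition germ_op (p : M) (D : (M -> R) -> R) : tvec :=
  fun f => if `[< smooth_at p f >] then D f else 0.

Definition tangent (p : M) (v : tvec) : Prop :=
  exists c, [/\ matlas c, cdom c p &
    exists a : 'rV[R]_n,
      v = germ_op p (fun f => 'D_a (f \o cinv c) (cmap c p))].

Definition vfield : Type := M -> tvec.

Definition vsmooth_on (W : set M) (X : vfield) : Prop :=
  (forall p, W p -> tangent p (X p)) /\
  (forall W' f, open W' -> W' `<=` W -> smooth_on W' f ->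
     smooth_on W' (fun q => X q f)).

Definition vsmooth_at (p : M) (X : vfield) : Prop :=
  exists W, [/\ open W, W p & vsmooth_on W X].

Definition lie (X Y : vfield) : vfield := fun p =>
  germ_op p (fun f => X p (fun q => Y q f) - Y p (fun q => X q f)).

(** ** Riemannian metrics, connections, curvature *)

Definition riemannian_metric (g : M -> tvec -> tvec -> R) : Prop :=
  [/\ forall p u v w (a : R), tangent p u -> tangent p v -> tangent p w ->
        g p (a *: u + v) w = a * g p u w + g p v w,
      forall p u v, tangent p u -> tangent p v -> g p u v = g p v u,
      forall p u, tangent p u -> u != 0 -> 0 < g p u u
    & forall W X Y, open W -> vsmooth_on W X -> vsmooth_on W Y ->
        smooth_on W (fun p => g p (X p) (Y p))].

(* [nabla p v Y] is the covariant derivative of the field Y along v at p.     *)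
Definition connection (nabla : M -> tvec -> vfield -> tvec) : Prop :=
  [/\ forall p v Y, tangent p v -> vsmooth_at p Y -> tangent p (nabla p v Y),
      forall p u v (a : R) Y, tangent p u -> tangent p v -> vsmooth_at p Y ->
        nabla p (a *: u + v) Y = a *: nabla p u Y + nabla p v Y,
      forall p v Y Z, tangent p v -> vsmooth_at p Y -> vsmooth_at p Z ->
        nabla p v (fun q => Y q + Z q) = nabla p v Y + nabla p v Z,
      forall p v f Y, tangent p v -> smooth_at p f -> vsmooth_at p Y ->
        nabla p v (fun q => f q *: Y q) = v f *: Y p + f p *: nabla p v Y
    & forall W X Y, open W -> vsmooth_on W X -> vsmooth_on W Y ->
        vsmooth_on W (fun p => nabla p (X p) Y)].

Definition levi_civita (g : M -> tvec -> tvec -> R)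
    (nabla : M -> tvec -> vfield -> tvec) : Prop :=
  [/\ connection nabla,
      forall p X Y, vsmooth_at p X -> vsmooth_at p Y ->
        nabla p (X p) Y - nabla p (Y p) X = lie X Y p
    & forall p v Y Z, tangent p v -> vsmooth_at p Y -> vsmooth_at p Z ->
        v (fun q => g q (Y q) (Z q)) =
        g p (nabla p v Y) (Z p) + g p (Y p) (nabla p v Z)].

(* O'Neill's sign: R(X,Y)Z = D_[X,Y] Z - D_X D_Y Z + D_Y D_X Z.               *)
Definition curv (D : M -> tvec -> vfield -> tvec) (X Y Z : vfield) : vfield :=
  fun p => D p (lie X Y p) Z - D p (X p) (fun q => D q (Y q) Z)
           + D p (Y p) (fun q => D q (X q) Z).

(* A smooth field near p extending the tangent vector v.                      *)
Definition extend (p : M) (v : tvec) : vfield :=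
  xget (fun=> 0) [set X : vfield | vsmooth_at p X /\ X p = v].

(* The curvature as a tensor at p; by tensoriality the choice of the          *)
(* extensions does not matter.                                                *)
Definition curv_at (nabla : M -> tvec -> vfield -> tvec)
    (p : M) (x y z : tvec) : tvec :=
  curv nabla (extend p x) (extend p y) (extend p z) p.

(** ** Quaternionic structures *)

(* [E p] is a set of endomorphisms of the tangent space at p; the values of   *)
(* these off the tangent space are ignored. The indices 1, 2, 3 are the       *)
(* residues modulo 3. The linear independence of the J_a follows from the     *)
(* quaternionic relations.                                                    *)
Definition quaternionic_basis (g : M -> tvec -> tvec -> R)
    (E : M -> set (tvec -> tvec)) (W : set M)
    (J : 'Z_3 -> M -> tvec -> tvec) : Prop :=
  [/\ [/\ forall a p v, W p -> tangent p v -> tangent p (J a p v),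
          forall a p u v (s : R), W p -> tangent p u -> tangent p v ->
            J a p (s *: u + v) = s *: J a p u + J a p v
        & forall a W' X, open W' -> W' `<=` W -> vsmooth_on W' X ->
            vsmooth_on W' (fun p => J a p (X p))],
      forall p, W p -> E p = [set A | exists t : 'Z_3 -> R,
        forall v, tangent p v -> A v = \sum_a t a *: J a p v],
      forall a p v, W p -> tangent p v -> J a p (J a p v) = - v,
      forall a p v, W p -> tangent p v ->
        J a p (J (a + 1) p v) = J (a + 2) p v /\
        J (a + 1) p (J a p v) = - J (a + 2) p v
    & forall a p u v, W p -> tangent p u -> tangent p v ->
        g p (J a p u) (J a p v) = g p u v].

Definition almost_quaternionic_hermitian (g : M -> tvec -> tvec -> R)
    (E : M -> set (tvec -> tvec)) : Prop :=
  riemannian_metric g /\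
  forall p, exists W J, [/\ open W, W p & quaternionic_basis g E W J].

Definition one_form (W : set M) (w : M -> tvec -> R) : Prop :=
  (forall p u v (s : R), W p -> tangent p u -> tangent p v ->
     w p (s *: u + v) = s * w p u + w p v) /\
  (forall W' X, open W' -> W' `<=` W -> vsmooth_on W' X ->
     smooth_on W' (fun p => w p (X p))).

Definition quaternionic_kaehler (g : M -> tvec -> tvec -> R)
    (nabla : M -> tvec -> vfield -> tvec)
    (E : M -> set (tvec -> tvec)) : Prop :=
  almost_quaternionic_hermitian g E /\
  forall W J, open W -> quaternionic_basis g E W J ->
    exists w : 'Z_3 -> M -> tvec -> R,
      (forall a, one_form W (w a)) /\
      (forall a p x Y, W p -> tangent p x -> vsmooth_at p Y ->
         nabla p x (fun q => J a q (Y q)) - J a p (nabla p x Y) =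
         w (a + 2) p x *: J (a + 1) p (Y p)
         - w (a + 1) p x *: J (a + 2) p (Y p)).

Definition quaternionic_space_form (g : M -> tvec -> tvec -> R)
    (nabla : M -> tvec -> vfield -> tvec)
    (E : M -> set (tvec -> tvec)) (c : R) : Prop :=
  quaternionic_kaehler g nabla E /\
  forall W J, open W -> quaternionic_basis g E W J ->
  forall p X Y Z, W p -> vsmooth_at p X -> vsmooth_at p Y -> vsmooth_at p Z ->
    curv nabla X Y Z p = (c / 4) *:
      (g p (Y p) (Z p) *: X p - g p (X p) (Z p) *: Y p
       + \sum_(a : 'Z_3)
           (g p (J a p (Y p)) (Z p) *: J a p (X p)
            - g p (J a p (X p)) (Z p) *: J a p (Y p)
            + (2 * g p (J a p (Y p)) (X p)) *: J a p (Z p))).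

End Manifold.

Arguments tvec {R n} M.
Arguments vfield {R n} M.

(** * Riemannian submersions *)

Section Submersion.
Context {R : realType} {m n : nat} {M : manifold R m} {N : manifold R n}.

Definition smooth_map (pi : M -> N) : Prop :=
  continuous pi /\
  forall c, matlas c -> forall j,
    smooth_on (pi @^-1` cdom c) (fun p => cmap c (pi p) ord0 j).

Definition pushforward (pi : M -> N) (p : M) (v : tvec M) : tvec N :=
  germ_op (pi p) (fun f => v (f \o pi)).

Variables (gM : M -> tvec M -> tvec M -> R) (gN : N -> tvec N -> tvec N -> R).
Variables (nabla : M -> tvec M -> vfield M -> tvec M).
Variables (nablaN : N -> tvec N -> vfield N -> tvec N).
Variable pi : M -> N.

Definition vertical (p : M) (v : tvec M) : Prop :=
  tangent p v /\ pushforward pi p v = 0.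

Definition horizontal (p : M) (v : tvec M) : Prop :=
  tangent p v /\ forall u, vertical p u -> gM p u v = 0.

Definition riemannian_submersion : Prop :=
  [/\ (n < m)%N, smooth_map pi, forall q, exists p, pi p = q,
      forall p w, tangent (pi p) w ->
        exists2 v, tangent p v & pushforward pi p v = w
    & forall p x y, horizontal p x -> horizontal p y ->
        gN (pi p) (pushforward pi p x) (pushforward pi p y) = gM p x y].

Definition anti_invariant (E : M -> set (tvec M -> tvec M)) : Prop :=
  forall W J, open W -> quaternionic_basis gM E W J ->
  forall a p u, W p -> vertical p u -> horizontal p (J a p u).

Definition vproj (p : M) (v : tvec M) : tvec M :=
  xget 0 [set u | vertical p u /\ horizontal p (v - u)].

Definition hproj (p : M) (v : tvec M) : tvec M := v - vproj p v.

Definition vpart (F : vfield M) : vfield M := fun p => vproj p (F p).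
Definition hpart (F : vfield M) : vfield M := fun p => hproj p (F p).

Definition oneillA (E F : vfield M) : vfield M := fun p =>
  hproj p (nabla p (hpart E p) (vpart F))
  + vproj p (nabla p (hpart E p) (hpart F)).

Definition oneillT (E F : vfield M) : vfield M := fun p =>
  hproj p (nabla p (vpart E p) (vpart F))
  + vproj p (nabla p (vpart E p) (hpart F)).

(* On the fibres, the vertical part of nabla is the Levi-Civita connection of *)
(* the induced metric; this is their intrinsic curvature.                     *)
Definition fiber_curv : vfield M -> vfield M -> vfield M -> vfield M :=
  curv (fun p v Y => vproj p (nabla p v Y)).

(* The horizontal lift of the curvature tensor of the base.                   *)
Definition base_curv (p : M) (x y z : tvec M) : tvec M :=
  xget 0 [set w | horizontal p w /\
    pushforward pi p w =
      curv_at nablaN (pi p)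
        (pushforward pi p x) (pushforward pi p y) (pushforward pi p z)].

Section Frame.
Variables (r l : nat) (U : 'I_r -> vfield M) (X : 'I_l -> vfield M).

(* U and X are smooth orthonormal frames over W of the vertical and of the    *)
(* horizontal distribution; in particular r and l are their ranks.            *)
Definition adapted_frame (W : set M) : Prop :=
  [/\ forall k, vsmooth_on W (U k), forall i, vsmooth_on W (X i),
      forall p, W p ->
        (forall k, vertical p (U k p)) /\ (forall i, horizontal p (X i p)),
      forall p, W p ->
        (forall k h, gM p (U k p) (U h p) = (k == h)%:R) /\
        (forall i j, gM p (X i p) (X j p) = (i == j)%:R)
    & forall p, W p ->
        (forall u, vertical p u ->
           exists t : 'I_r -> R, u = \sum_k t k *: U k p) /\
        (forall x, horizontal p x ->
           exists t : 'I_l -> R, x = \sum_i t i *: X i p)].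

Definition sqB (J : M -> tvec M -> tvec M) (i : 'I_l) (p : M) : R :=
  \sum_(k < r) gM p (vproj p (J p (X i p))) (U k p) ^+ 2.

Definition sqC (J : M -> tvec M -> tvec M) (i : 'I_l) (p : M) : R :=
  \sum_(j < l) gM p (hproj p (J p (X i p))) (X j p) ^+ 2.

Definition sqTV (p : M) : R :=
  \sum_(i < l) \sum_(k < r) gM p (oneillT (U k) (X i) p) (oneillT (U k) (X i) p).

Definition sqAV (p : M) : R :=
  \sum_(i < l) \sum_(j < l) gM p (oneillA (X i) (X j) p) (oneillA (X i) (X j) p).

Definition sqAH (p : M) : R :=
  \sum_(i < l) \sum_(k < r) gM p (oneillA (X i) (U k) p) (oneillA (X i) (U k) p).

Definition normal_field : vfield M := fun p =>
  \sum_(j < r) oneillT (U j) (U j) p.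

Definition mean_curv : vfield M := fun p => r%:R^-1 *: normal_field p.

Definition deltaN (p : M) : R :=
  \sum_(i < l) gM p (nabla p (X i p) normal_field) (X i p).

Definition tau_fiber (p : M) : R :=
  \sum_(i < r) \sum_(j < r) gM p (fiber_curv (U j) (U i) (U i) p) (U j p).

Definition tau_base (p : M) : R :=
  \sum_(i < l) \sum_(j < l) gM p (base_curv p (X i p) (X j p) (X j p)) (X i p).

Definition umbilical_fibers_on (W : set M) : Prop :=
  forall W' V1 V2, open W' -> W' `<=` W ->
    vsmooth_on W' V1 -> vsmooth_on W' V2 ->
    (forall p, W' p -> vertical p (V1 p) /\ vertical p (V2 p)) ->
    forall p, W' p -> oneillT V1 V2 p = gM p (V1 p) (V2 p) *: mean_curv p.

Definition submersion_lhs (c : R) (J : 'Z_3 -> M -> tvec M -> tvec M)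
    (p : M) : R :=
  c / 4 * ((l + r)%:R * ((l + r)%:R - 1)
           + \sum_(a : 'Z_3) \sum_(i < l)
               (6 * sqB (J a) i p + 3 * sqC (J a) i p)).

Definition submersion_rhs (p : M) : R :=
  tau_fiber p + tau_base p
  + r%:R * (r%:R - 1) * gM p (mean_curv p) (mean_curv p)
  + 3 * sqAV p - 2 * deltaN p + 2 * sqTV p - 2 * sqAH p.

End Frame.

End Submersion.

(* Main.v *)
Require Import Defs.
From mathcomp Require Import all_boot all_order all_algebra.
From mathcomp Require Import all_classical all_reals all_analysis.
From mathcomp Require Import ring lra.

Set Implicit Arguments.
Unset Strict Implicit.
Unset Printing Implicit Defensive.
Import Order.TTheory GRing.Theory Num.Theory.
Import numFieldNormedType.Exports.
Local Open Scope classical_set_scope.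
Local Open Scope ring_scope.

(* Summing the curvature of the space form over all pairs of vectors of the   *)
(* adapted frame gives the left-hand side. Splitting the sum into vertical,   *)
(* horizontal and mixed pairs and applying O'Neill's equations gives          *)
(*   tau_fiber + r^2 |H|^2 - sum_ij |T_ij|^2 + tau_base + 3 |A^V|^2           *)
(*     + 2 (|T^V|^2 - |A^H|^2 - delta(N)),                                    *)
(* so the right-hand side exceeds the left-hand side by                       *)
(* sum_ij |T_ij|^2 - r |H|^2 = sum_ij |T_ij - delta_ij H|^2. The vertical and *)
(* mixed equations are computed on the frame fields themselves; the           *)
(* horizontal one on horizontal lifts of fields of the base, whose covariant  *)
(* derivatives are compared by the Koszul formula. Tensoriality of the        *)
(* curvature of M is never needed, because the space form condition gives it  *)
(* for arbitrary fields.                                                      *)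

(** * Calculus of C^k functions *)

(** The space form condition gives R(Y,Z,Z,Y) = c/4 (|Y|^2 |Z|^2 - g(Y,Z)^2 + 3 sum_a g(J_a Y,
    Z)^2), see [space_form_curvature]. On pairs of vertical frame vectors the J-terms vanish by
    anti-invariance; horizontal pairs produce the C-terms with factor 3; mixed pairs occur in both
    orders and produce the B-terms with factor 6, together with the cross term 2lr of (l+r)(l+r-1).

    The same sums are computed by contracted O'Neill equations: [vertical_curvature] is a Gauss
    equation for the fibres, [horizontal_curvature] adds 3|A_X Y|^2 to the curvature of the base,
    and [mixed_curvature] yields |T_U X|^2 - |A_X U|^2 minus a derivative of T, whose trace is
    delta(N) because the terms with connection coefficients cancel ([sum_metric_nabla_connection]).
    Two symmetries carry these computations: T is symmetric on vertical fields, since their brackets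
    are vertical, and A is alternating on horizontal fields ([vproj_nabla_anti]).

    [submersion_defect] assembles everything into an exact identity whose remainder is a sum of
    squares. Its nonnegativity is the inequality. Equality means T_ij = delta_ij H on the frame,
    which [umbilical_frame] extends by bilinearity to all vertical fields; the off-diagonal entries
    are condition (2). *)

Section NearDifferential.
Context {R : numFieldType} {V W : normedModType R}.

(** The differential of [f] at [x] also satisfies the first-order expansion of [g], so by uniqueness
    it is the differential of [g]. *)
Lemma near_eq_differentiable (f g : V -> W) (x : V) :
  (\forall y \near x, f y = g y) -> differentiable f x -> differentiable g x.
Proof.
move=> fg df.
have fxgx : f x = g x by exact: (nbhs_singleton fg).
have [dfc /eqaddoP dfE] := (diff_locallyP _ _).1 df.
have fg0 : \forall h \near (0 : V), f (h + x) = g (h + x).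
  by move: fg; rewrite (near_shift 0) subr0.
have dgE : g \o shift x = cst (g x) + 'd f x +o_ (0 : V) id.
  apply/eqaddoP => e e0; have := dfE e e0; apply: filterS2 fg0 => h /= fgh.
  by rewrite !fctE /= => he; rewrite -fgh -fxgx; exact: he.
have dg := diff_unique dfc dgE.
by apply/diff_locallyP; rewrite dg.
Qed.

End NearDifferential.

Section Calculus.
Context {R : realType}.
Implicit Types (m n k : nat).

Lemma differentiable_row m n (G : 'rV[R]_m -> 'rV[R]_n) x :
  (forall j, differentiable (fun y => G y ord0 j) x) -> differentiable G x.
Proof.
move=> dG.
rewrite (_ : G = \sum_(j < n) (fun y => G y ord0 j *: delta_mx ord0 j)).
  by apply: differentiable_sum => j; exact: differentiableZl.
apply/funext => y; rewrite fct_sumE; exact: row_sum_delta.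
Qed.

Lemma derive_sum_coord n (f : 'rV[R]_n -> R) x (v : 'rV[R]_n) :
  differentiable f x ->
  'D_v f x = \sum_j v ord0 j * 'D_(delta_mx ord0 j) f x.
Proof.
move=> df; rewrite deriveE // {1}(row_sum_delta v) linear_sum /=.
by apply: eq_bigr => j _; rewrite linearZ deriveE.
Qed.

Lemma derive_comp_row m n (f : 'rV[R]_n -> R) (G : 'rV[R]_m -> 'rV[R]_n) x v :
  (forall j, differentiable (fun y => G y ord0 j) x) ->
  differentiable f (G x) ->
  'D_v (f \o G) x =
  \sum_j 'D_v (fun y => G y ord0 j) x * 'D_(delta_mx ord0 j) f (G x).
Proof.
move=> dG df; have dGx := differentiable_row dG.
rewrite deriveE; last exact: differentiable_comp.
rewrite diff_comp //= -deriveE // derive_sum_coord //.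
apply: eq_bigr => j _; congr (_ * _).
rewrite -deriveE // derive_mx ?mxE //; exact: diff_derivable.
Qed.

Lemma Ck_sub n k (D D' : set 'rV[R]_n) (f : 'rV[R]_n -> R) :
  D' `<=` D -> Ck k D f -> Ck k D' f.
Proof.
move=> sD; elim: k f => [|k IH] f /=; first by move=> h x /sD; exact: h.
by move=> [h1 h2]; split=> [x /sD|i]; [exact: h1 | exact: IH].
Qed.

(** [Ck] is a conjunction of conditions at the points of the set, each on a total function near that
    point, so it can be checked one point at a time. *)
Lemma Ck_local n k (D : set 'rV[R]_n) (f : 'rV[R]_n -> R) :
  (forall x, D x -> exists2 D', D' x & Ck k D' f) -> Ck k D f.
Proof.
elim: k f => [|k IH] f /= h; first by move=> x /h[D' D'x]; apply.
split=> [x /h[D' D'x [+ _]]|i]; first exact.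
by apply: IH => x /h[D' D'x [_ ?]]; exists D'.
Qed.

Lemma Ck_eq n k (D : set 'rV[R]_n) (f g : 'rV[R]_n -> R) :
  open D -> (forall x, D x -> f x = g x) -> Ck k D f -> Ck k D g.
Proof.
move=> oD; elim: k f g => [|k IH] f g fg /=.
  move=> h x Dx; have : f @ x --> f x := h x Dx.
  rewrite (fg x Dx) => hx; apply: cvg_trans hx.
  apply: (@near_eq_cvg _ _ (nbhs x)).
  apply: filterS (open_nbhs_nbhs (conj oD Dx)) => y Dy.
  by rewrite fg.
have nfg x : D x -> \forall y \near x, f y = g y.
  by move=> Dx; apply: filterS (open_nbhs_nbhs (conj oD Dx)) => y Dy; exact: fg.
move=> [h1 h2]; split=> [x Dx|i].
  by apply: near_eq_differentiable (h1 x Dx); exact: nfg.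
by apply: IH (h2 i) => x Dx; apply: near_eq_derive; exact: nfg.
Qed.

Lemma CkW n k (D : set 'rV[R]_n) (f : 'rV[R]_n -> R) : Ck k.+1 D f -> Ck k D f.
Proof.
elim: k f => [|k IH] f.
  by move=> [h _] x Dx; exact: differentiable_continuous (h x Dx).
by move=> [h1 h2]; split=> // i; exact: IH.
Qed.

Lemma Ck_cst n k (D : set 'rV[R]_n) (a : R) : Ck k D (fun _ => a).
Proof.
elim: k a => [|k IH] a /=; first by move=> x _; exact: cst_continuous.
split=> [x _|i]; first exact: differentiable_cst.
have -> : (fun x : 'rV[R]_n => 'D_(delta_mx ord0 i) (fun=> a) x) = (fun=> 0 : R).
  by apply/funext => x; rewrite (derive_cst a).
exact: IH.
Qed.

Lemma Ck_add n k (D : set 'rV[R]_n) (f g : 'rV[R]_n -> R) : open D ->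
  Ck k D f -> Ck k D g -> Ck k D (fun x => f x + g x).
Proof.
move=> oD; elim: k f g => [|k IH] f g /=.
  by move=> hf hg x Dx; exact: (continuousD (hf x Dx) (hg x Dx)).
move=> [hf1 hf2] [hg1 hg2]; split=> [x Dx|i].
  by apply: differentiableD; [exact: hf1 | exact: hg1].
apply: Ck_eq (IH _ _ (hf2 i) (hg2 i)) => // x Dx.
by rewrite -deriveD //; apply: diff_derivable; [exact: hf1|exact: hg1].
Qed.

Lemma Ck_mul n k (D : set 'rV[R]_n) (f g : 'rV[R]_n -> R) : open D ->
  Ck k D f -> Ck k D g -> Ck k D (fun x => f x * g x).
Proof.
move=> oD; elim: k f g => [|k IH] f g.
  by move=> hf hg x Dx; exact: (continuousM (hf x Dx) (hg x Dx)).
move=> hf hg; have [hf1 hf2] := hf; have [hg1 hg2] := hg; split=> [x Dx|i].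
  by apply: differentiableM; [exact: hf1 | exact: hg1].
apply: Ck_eq oD _ (Ck_add oD (IH _ _ (CkW hf) (hg2 i))
  (IH _ _ (CkW hg) (hf2 i))) => x Dx.
by rewrite -[RHS]/('D_(delta_mx ord0 i) (f * g) x) deriveM //;
  apply: diff_derivable; [exact: hf1|exact: hg1].
Qed.

Lemma Ck_sum n k (D : set 'rV[R]_n) (I : Type) (s : seq I)
    (f : I -> 'rV[R]_n -> R) : open D ->
  (forall i, Ck k D (f i)) -> Ck k D (fun x => \sum_(i <- s) f i x).
Proof.
move=> oD hf; elim: s => [|i s IH].
  have -> : (fun x => \sum_(i <- [::]) f i x) = (fun=> 0 : R).
    by apply/funext => x; rewrite big_nil.
  exact: Ck_cst.
have -> : (fun x => \sum_(i <- i :: s) f i x)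
    = fun x => f i x + \sum_(i <- s) f i x.
  by apply/funext => x; rewrite big_cons.
exact: Ck_add.
Qed.

Lemma Cinf_differentiable n (D : set 'rV[R]_n) (f : 'rV[R]_n -> R) x :
  Cinf D f -> D x -> differentiable f x.
Proof. by move=> /(_ 1) [h _]; exact: h. Qed.

Lemma Cinf_derive n (D : set 'rV[R]_n) (f : 'rV[R]_n -> R) (v : 'rV[R]_n) :
  open D -> Cinf D f -> Cinf D (fun x => 'D_v f x).
Proof.
move=> oD hf k.
apply: (@Ck_eq _ _ _ (fun x => \sum_j v ord0 j * 'D_(delta_mx ord0 j) f x)) => //.
  by move=> x Dx; rewrite -derive_sum_coord //; exact: Cinf_differentiable hf Dx.
apply: Ck_sum => // j; apply: Ck_mul => //; first exact: Ck_cst.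
by have [_] := hf k.+1; apply.
Qed.

(** Induction on the order with [f] general: by the chain rule a partial derivative of [f \o G] is a
    sum of partials of the components of [G] times partials of [f] composed with [G], and those
    partials of [f] are again [Cinf]. *)
Lemma Cinf_comp m n (D : set 'rV[R]_m) (D' : set 'rV[R]_n)
    (f : 'rV[R]_n -> R) (G : 'rV[R]_m -> 'rV[R]_n) : open D ->
  (forall j, Cinf D (fun x => G x ord0 j)) ->
  (forall x, D x -> D' (G x)) -> Cinf D' f -> Cinf D (f \o G).
Proof.
move=> oD hG hD hf k; elim: k f hf => [|k IH] f hf.
  move=> x Dx; apply: differentiable_continuous.
  apply: differentiable_comp.
    by apply: differentiable_row => j; exact: Cinf_differentiable (hG j) Dx.
  exact: Cinf_differentiable hf (hD x Dx).
have dG x j : D x -> differentiable (fun y => G y ord0 j) x.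
  by move=> Dx; exact: Cinf_differentiable (hG j) Dx.
have df x : D x -> differentiable f (G x).
  by move=> Dx; exact: Cinf_differentiable hf (hD x Dx).
split=> [x Dx|i].
  apply: differentiable_comp; last exact: df.
  by apply: differentiable_row => j; exact: dG.
apply: (@Ck_eq _ _ _ (fun x => \sum_j 'D_(delta_mx ord0 i) (fun y => G y ord0 j) x
   * (fun y => 'D_(delta_mx ord0 j) f y) (G x))) => //.
  by move=> x Dx; rewrite derive_comp_row // => [j|]; [exact: dG | exact: df].
apply: Ck_sum => // j; apply: Ck_mul => //.
  by have [_ h] := hG j k.+1; exact: h.
apply: (IH (fun y => 'D_(delta_mx ord0 j) f y)) => k'.
by have [_ h] := hf k'.+1; exact: h.
Qed.

End Calculus.

(** * Smooth functions and tangent vectors *)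

Lemma near_open (T : topologicalType) (W : set T) (p : T) (P : T -> Prop) :
  open W -> W p -> (forall q, W q -> P q) -> \forall q \near p, P q.
Proof. by move=> oW Wp WP; exact: filterS WP (open_nbhs_nbhs (conj oW Wp)). Qed.

Lemma near_openP (T : topologicalType) (p : T) (P : T -> Prop) :
  (\forall q \near p, P q) -> exists W, [/\ open W, W p & forall q, W q -> P q].
Proof.
move=> nP; have : nbhs p P := nP.
by rewrite nbhsE => -[W [oW Wp] WP]; exists W.
Qed.

Section SmoothFunctions.
Context {R : realType} {n : nat} {M : manifold R n}.
Implicit Types (p q : M) (W : set M) (f g : M -> R) (c : chart R n M).

(** Near [cmap c p] the image is the preimage of [W] under [cinv c], which is continuous there, cut
    with the open image of the chart domain. *)
Lemma chart_img_open c W : matlas c -> open W ->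
  open (cmap c @` (cdom c `&` W)).
Proof.
move=> /mcharts[od oi cK _ ccont] oW; rewrite openE => _ [p [dp Wp] <-].
have ip : (cmap c @` cdom c) (cmap c p) by exists p.
have nW : nbhs (cinv c (cmap c p)) W by rewrite cK //; exact: open_nbhs_nbhs.
have := ccont p dp W nW; apply: filterS2 (open_nbhs_nbhs (conj oi ip)).
by move=> _ [q dq <-] /=; rewrite cK // => Wq; exists q.
Qed.

Lemma smooth_onS W W' f : W' `<=` W -> smooth_on W f -> smooth_on W' f.
Proof.
move=> sW h c ac k; apply: Ck_sub (h c ac k) => _ [p [dp Wp] <-].
by exists p => //; split=> //; exact: sW.
Qed.

Lemma smooth_on_local W f :
  (forall p, W p -> exists2 W', W' p & smooth_on W' f) -> smooth_on W f.
Proof.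
move=> h c ac k; apply: Ck_local => _ [p [dp /h[W' W'p sf]] <-].
by exists (cmap c @` (cdom c `&` W')); [exists p | exact: sf].
Qed.

Lemma smooth_on_at W f : (forall p, W p -> smooth_at p f) -> smooth_on W f.
Proof. by move=> h; apply: smooth_on_local => p /h[W' [_ ? ?]]; exists W'. Qed.

Lemma smooth_on_eq W f g : open W -> (forall p, W p -> f p = g p) ->
  smooth_on W f -> smooth_on W g.
Proof.
move=> oW fg h c ac k; have [_ _ cK _ _] := mcharts ac.
apply: Ck_eq (h c ac k); first exact: chart_img_open.
by move=> _ [p [dp Wp] <-] /=; rewrite cK // fg.
Qed.

Lemma smooth_at_near p f : smooth_at p f -> \forall q \near p, smooth_at q f.
Proof.
by move=> [W [oW Wp sf]]; apply: (near_open oW Wp) => q Wq; exists W; split.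
Qed.

Lemma smooth_at_eq p f g : (\forall q \near p, f q = g q) ->
  smooth_at p f -> smooth_at p g.
Proof.
move=> /near_openP[W' [oW' W'p fg]] [W [oW Wp sf]].
exists (W `&` W'); split=> //; first exact: openI.
apply: (@smooth_on_eq _ f) => [|q [_ /fg]//|]; first exact: openI.
by apply: smooth_onS sf => q [].
Qed.

Lemma smooth_at_eqE p f g : (\forall q \near p, f q = g q) ->
  smooth_at p f <-> smooth_at p g.
Proof.
move=> fg; split; first exact: smooth_at_eq.
by apply: smooth_at_eq; apply: filterS fg.
Qed.

Lemma smooth_at_cst p (a : R) : smooth_at p (fun=> a).
Proof.
by exists setT; split=> //; [exact: openT | move=> c _ k; exact: Ck_cst].
Qed.

Lemma smooth_at_add p f g : smooth_at p f -> smooth_at p g ->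
  smooth_at p (fun q => f q + g q).
Proof.
move=> [W [oW Wp sf]] [W' [oW' W'p sg]].
exists (W `&` W'); split=> //; first exact: openI.
move=> c ac k; apply: Ck_add; first by apply: chart_img_open => //; exact: openI.
  by apply: (smooth_onS _ sf) => // q [].
by apply: (smooth_onS _ sg) => // q [].
Qed.

Lemma smooth_at_mul p f g : smooth_at p f -> smooth_at p g ->
  smooth_at p (fun q => f q * g q).
Proof.
move=> [W [oW Wp sf]] [W' [oW' W'p sg]].
exists (W `&` W'); split=> //; first exact: openI.
move=> c ac k; apply: Ck_mul; first by apply: chart_img_open => //; exact: openI.
  by apply: (smooth_onS _ sf) => // q [].
by apply: (smooth_onS _ sg) => // q [].
Qed.

Lemma smooth_at_sum p (I : Type) (s : seq I) (f : I -> M -> R) :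
  (forall i, smooth_at p (f i)) -> smooth_at p (fun q => \sum_(i <- s) f i q).
Proof.
move=> sf; elim: s => [|i s IH].
  apply: smooth_at_eq (smooth_at_cst p 0).
  by apply: nearW => q; rewrite big_nil.
apply: smooth_at_eq (smooth_at_add (sf i) IH).
by apply: nearW => q; rewrite big_cons.
Qed.

Lemma smooth_at_comp k p (phi : M -> 'rV[R]_k) (D : set 'rV[R]_k)
    (h : 'rV[R]_k -> R) :
  (forall j, smooth_at p (fun q => phi q ord0 j)) ->
  (\forall q \near p, D (phi q)) -> Cinf D h -> smooth_at p (h \o phi).
Proof.
move=> sphi nD hh.
have nphi : \forall q \near p, forall j, smooth_at q (fun q => phi q ord0 j).
  by apply: filter_forall => j; exact: smooth_at_near.
have [W [oW Wp hW]] := near_openP (filterI nD nphi).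
exists W; split=> // c ac; have [_ _ cK _ _] := mcharts ac.
apply: (@Cinf_comp _ _ _ _ D h (phi \o cinv c)) => //.
- exact: chart_img_open.
- move=> j; have : smooth_on W (fun q => phi q ord0 j).
    by apply: smooth_on_at => q /hW[_]; exact.
  by apply.
- by move=> _ [q [dq Wq] <-] /=; rewrite cK //; have [] := hW q Wq.
Qed.

Lemma smooth_at_cmap c p j : matlas c -> cdom c p ->
  smooth_at p (fun q => cmap c q ord0 j).
Proof.
move=> ac dp; have [od _ _ _ _] := mcharts ac; exists (cdom c); split=> //.
by move=> c' ac'; exact: mcompat.
Qed.

Lemma smooth_at_chart c p f : matlas c -> cdom c p -> smooth_at p f ->
  exists D, [/\ open D, D (cmap c p), Cinf D (f \o cinv c)
    & \forall q \near p, D (cmap c q)].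
Proof.
move=> ac dp [W [oW Wp sf]]; have [od _ _ _ _] := mcharts ac.
exists (cmap c @` (cdom c `&` W)); split.
- exact: chart_img_open.
- by exists p.
- exact: sf.
- apply: (near_open (openI od oW)) => // q [dq Wq]; exact/imageP.
Qed.

Lemma near_chartK c p f : matlas c -> cdom c p ->
  \forall q \near p, (f \o cinv c \o cmap c) q = f q.
Proof.
move=> ac dp; have [od _ cK _ _] := mcharts ac.
by apply: (near_open od dp) => q dq /=; rewrite cK.
Qed.

End SmoothFunctions.

(** * Tangent vectors as operators, and their expression in charts *)

Section TangentVectors.
Context {R : realType} {n : nat} {M : manifold R n}.
Implicit Types (p q : M) (W : set M) (f g : M -> R) (c : chart R n M).
Implicit Types (u v w : tvec M).

Lemma tvec_sumE (I : Type) (s : seq I) (P : pred I) (F : I -> tvec M) f :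
  (\sum_(i <- s | P i) F i) f = \sum_(i <- s | P i) F i f.
Proof. by elim/big_rec2: _ => // i x y _ <-. Qed.

Lemma germ_opE p (D : (M -> R) -> R) f : smooth_at p f -> germ_op p D f = D f.
Proof. by move=> sf; rewrite /germ_op asboolT. Qed.

Lemma germ_op0 p (D : (M -> R) -> R) f : ~ smooth_at p f -> germ_op p D f = 0.
Proof. by move=> sf; rewrite /germ_op asboolF. Qed.

Lemma tangent_nonsmooth p v f : tangent p v -> ~ smooth_at p f -> v f = 0.
Proof. by move=> [c [_ _ [a ->]]]; exact: germ_op0. Qed.

Lemma tangent_eq p u v : tangent p u -> tangent p v ->
  (forall f, smooth_at p f -> u f = v f) -> u = v.
Proof.
move=> tu tv uv; apply/funext => f; have [/uv//|nf] := pselect (smooth_at p f).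
by rewrite (tangent_nonsmooth tu nf) (tangent_nonsmooth tv nf).
Qed.

(** The chain rule for a function of finitely many smooth functions. Taking for [phi] a chart gives
    the coordinate formula; taking base coordinates composed with the submersion gives tangency of
    pushforwards. *)
Lemma tangent_comp k p v (phi : M -> 'rV[R]_k) (D : set 'rV[R]_k)
    (h : 'rV[R]_k -> R) : tangent p v ->
  (forall j, smooth_at p (fun q => phi q ord0 j)) ->
  (\forall q \near p, D (phi q)) -> Cinf D h ->
  v (h \o phi) =
  \sum_j v (fun q => phi q ord0 j) * 'D_(delta_mx ord0 j) h (phi p).
Proof.
move=> [c [ac dp [a ->]]] sphi nD hh; have [_ _ cK _ _] := mcharts ac.
rewrite germ_opE; last exact: smooth_at_comp hh.
have dphi j : differentiable (fun y => (phi \o cinv c) y ord0 j) (cmap c p).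
  have [D' [_ D'p hD' _]] := smooth_at_chart ac dp (sphi j).
  exact: Cinf_differentiable hD' D'p.
rewrite -[(h \o phi) \o cinv c]/(h \o (phi \o cinv c)) derive_comp_row //=.
  by apply: eq_bigr => j _; rewrite germ_opE // cK.
by rewrite cK //; apply: Cinf_differentiable hh _; exact: nbhs_singleton nD.
Qed.

(** Smoothness at [p] is itself local, so functions that are not smooth near [p] cause no trouble:
    both sides then take the default value 0. *)
Lemma tangent_near p v f g : tangent p v -> (\forall q \near p, f q = g q) ->
  v f = v g.
Proof.
move=> tv fg; have [sf|nf] := pselect (smooth_at p f); last first.
  rewrite (tangent_nonsmooth tv nf) (tangent_nonsmooth tv) //.
  by rewrite -(smooth_at_eqE fg).
have sg := smooth_at_eq fg sf; move: tv => [c [ac dp [a ->]]].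
rewrite !germ_opE //; have [_ oi cK _ ccont] := mcharts ac.
apply: near_eq_derive.
have : cinv c @ cmap c p --> cinv c (cmap c p) := ccont p dp.
by rewrite cK // => /(_ _ fg).
Qed.

Lemma tangent_chart c p v f : matlas c -> cdom c p -> tangent p v ->
  smooth_at p f ->
  v f = \sum_j v (fun q => cmap c q ord0 j)
         * 'D_(delta_mx ord0 j) (f \o cinv c) (cmap c p).
Proof.
move=> ac dp tv sf; have [D [_ _ hD nD]] := smooth_at_chart ac dp sf.
have -> : v f = v ((f \o cinv c) \o cmap c).
  apply: (tangent_near tv).
  by apply: filterS (near_chartK f ac dp) => q /= ->.
apply: tangent_comp hD => // j; exact: smooth_at_cmap.
Qed.

(** Together with [tangent_chart] this characterises tangency in any one chart at [p], so vectors
    presented in different charts can be added and pushed forward. *)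
Lemma tangentI c p v : matlas c -> cdom c p ->
  (forall f, ~ smooth_at p f -> v f = 0) ->
  (forall f, smooth_at p f -> v f = \sum_j v (fun q => cmap c q ord0 j)
         * 'D_(delta_mx ord0 j) (f \o cinv c) (cmap c p)) ->
  tangent p v.
Proof.
move=> ac dp v0 vE; exists c; split=> //.
exists (\row_j v (fun q => cmap c q ord0 j)); apply/funext => f.
have [sf|nf] := pselect (smooth_at p f); last by rewrite germ_op0 // v0.
have [D [_ Dp hD _]] := smooth_at_chart ac dp sf.
rewrite germ_opE // vE // [RHS]derive_sum_coord.
  by apply: eq_bigr => j _; rewrite mxE.
exact: Cinf_differentiable hD Dp.
Qed.

Lemma tangent_lin p u v (a : R) : tangent p u -> tangent p v ->
  tangent p (a *: u + v).
Proof.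
move=> tu tv; have [c ac dp] := mcover p; apply: (tangentI ac dp) => f sf.
  rewrite -[LHS]/(a * u f + v f) (tangent_nonsmooth tu sf).
  by rewrite (tangent_nonsmooth tv sf) mulr0 addr0.
rewrite -[LHS]/(a * u f + v f) (tangent_chart ac dp tu sf).
rewrite (tangent_chart ac dp tv sf) mulr_sumr -big_split; apply: eq_bigr => j _.
by rewrite /= mulrA -mulrDl.
Qed.

Lemma tangent0 p : tangent p (0 : tvec M).
Proof.
have [c ac dp] := mcover p; apply: (tangentI ac dp) => // f _.
by rewrite -[LHS]/(0 : R) big1 // => j _; rewrite -[X in X * _]/(0 : R) mul0r.
Qed.

Lemma tangentD p u v : tangent p u -> tangent p v -> tangent p (u + v).
Proof. by move=> tu tv; rewrite -[u]scale1r; exact: tangent_lin. Qed.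

Lemma tangentZ p u (a : R) : tangent p u -> tangent p (a *: u).
Proof.
by move=> tu; rewrite -[_ *: _]addr0; apply: tangent_lin => //; exact: tangent0.
Qed.

Lemma tangentN p u : tangent p u -> tangent p (- u).
Proof. by move=> tu; rewrite -scaleN1r; exact: tangentZ. Qed.

Lemma tangentB p u v : tangent p u -> tangent p v -> tangent p (u - v).
Proof. by move=> tu tv; apply: tangentD => //; exact: tangentN. Qed.

Lemma tangent_sum p (I : Type) (s : seq I) (F : I -> tvec M) :
  (forall i, tangent p (F i)) -> tangent p (\sum_(i <- s) F i).
Proof.
move=> tF; elim/big_ind: _ => //; [exact: tangent0 | move=> *; exact: tangentD].
Qed.

Lemma tangent_derive c p (a : 'rV[R]_n) : matlas c -> cdom c p ->
  tangent p (germ_op p (fun f => 'D_a (f \o cinv c) (cmap c p))).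
Proof. by move=> ac dp; exists c; split=> //; exists a. Qed.

Lemma tangent_cst p v (a : R) : tangent p v -> v (fun=> a) = 0.
Proof.
move=> [c [ac dp [b ->]]]; rewrite germ_opE; last exact: smooth_at_cst.
by rewrite -[_ \o _]/(fun=> a) (derive_cst a).
Qed.

Lemma tangent_near0 p v f (a : R) : tangent p v ->
  (\forall q \near p, f q = a) -> v f = 0.
Proof. by move=> tv fa; rewrite (tangent_near tv fa) (tangent_cst _ tv). Qed.

End TangentVectors.

(** * Vector fields, metrics and connections *)

Section VectorFields.
Context {R : realType} {n : nat} {M : manifold R n}.
Implicit Types (p q : M) (W : set M) (f g : M -> R) (c : chart R n M).
Implicit Types (u v w : tvec M) (X Y Z : vfield M).

Lemma vsmooth_at_tangent p X : vsmooth_at p X -> tangent p (X p).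
Proof. by move=> [W [_ Wp [h _]]]; exact: h. Qed.

Lemma vsmooth_at_near p X : vsmooth_at p X -> \forall q \near p, vsmooth_at q X.
Proof.
by move=> [W [oW Wp sX]]; apply: (near_open oW Wp) => q Wq; exists W; split.
Qed.

Lemma vsmooth_at_app p X f : vsmooth_at p X -> smooth_at p f ->
  smooth_at p (fun q => X q f).
Proof.
move=> [W [oW Wp [_ h]]] [W' [oW' W'p sf]].
exists (W `&` W'); split=> //; first exact: openI.
apply: h; [exact: openI | by move=> q [] | by apply: smooth_onS sf => q []].
Qed.

Lemma vsmooth_atI p X :
  (\forall q \near p, tangent q (X q) /\
     forall f, smooth_at q f -> smooth_at q (fun q => X q f)) ->
  vsmooth_at p X.
Proof.
move=> nX; have [W [oW Wp h]] := near_openP nX.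
exists W; split=> //; split=> [q /h[]//|].
move=> W' f oW' sW sf; apply: smooth_on_at => q W'q.
by have [_] := h q (sW q W'q); apply; exists W'; split.
Qed.

Lemma vsmooth_on_at W X : (forall p, W p -> vsmooth_at p X) -> vsmooth_on W X.
Proof.
move=> h; split=> [p /h /vsmooth_at_tangent//|W' f oW' sW sf].
apply: smooth_on_at => p W'p; apply: vsmooth_at_app; first exact/h/sW.
by exists W'; split.
Qed.

Lemma vsmooth_onP W X : open W ->
  vsmooth_on W X <-> forall p, W p -> vsmooth_at p X.
Proof.
move=> oW; split; last exact: vsmooth_on_at.
by move=> sX p Wp; exists W; split.
Qed.

Lemma vsmooth_at_eq p X Y : (\forall q \near p, X q = Y q) ->
  vsmooth_at p X -> vsmooth_at p Y.
Proof.
move=> XY sX; apply: vsmooth_atI; have := near_join XY.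
apply: filterS2 (vsmooth_at_near sX) => q sq nq; split.
  by rewrite -(nbhs_singleton nq); exact: vsmooth_at_tangent.
move=> f sf; apply: smooth_at_eq (vsmooth_at_app sq sf).
by apply: filterS nq => q' ->.
Qed.

Lemma vsmooth_at_add p X Y : vsmooth_at p X -> vsmooth_at p Y ->
  vsmooth_at p (fun q => X q + Y q).
Proof.
move=> sX sY; apply: vsmooth_atI.
apply: filterS2 (vsmooth_at_near sX) (vsmooth_at_near sY) => q hX hY.
split; first by apply: tangentD; exact: vsmooth_at_tangent.
by move=> f sf; apply: smooth_at_add; exact: vsmooth_at_app.
Qed.

Lemma vsmooth_at_scale p f X : smooth_at p f -> vsmooth_at p X ->
  vsmooth_at p (fun q => f q *: X q).
Proof.
move=> sf sX; apply: vsmooth_atI.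
apply: filterS2 (smooth_at_near sf) (vsmooth_at_near sX) => q hf hX.
split; first by apply: tangentZ; exact: vsmooth_at_tangent.
by move=> g sg; apply: smooth_at_mul => //; exact: vsmooth_at_app.
Qed.

Lemma vsmooth_at0 p : vsmooth_at p (fun=> 0 : tvec M).
Proof.
apply: vsmooth_atI; apply: nearW => q; split; first exact: tangent0.
by move=> f _; exact: smooth_at_cst.
Qed.

Lemma vsmooth_at_opp p X : vsmooth_at p X -> vsmooth_at p (fun q => - X q).
Proof.
move=> /(vsmooth_at_scale (smooth_at_cst p (-1))); apply: vsmooth_at_eq.
by apply: nearW => q; rewrite scaleN1r.
Qed.

Lemma vsmooth_at_sub p X Y : vsmooth_at p X -> vsmooth_at p Y ->
  vsmooth_at p (fun q => X q - Y q).
Proof. by move=> sX sY; apply: vsmooth_at_add => //; exact: vsmooth_at_opp. Qed.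

Lemma vsmooth_at_sum p (I : Type) (s : seq I) (X : I -> vfield M) :
  (forall i, vsmooth_at p (X i)) -> vsmooth_at p (fun q => \sum_(i <- s) X i q).
Proof.
move=> sX; elim: s => [|i s IH].
  by apply: vsmooth_at_eq (vsmooth_at0 p); apply: nearW => q; rewrite big_nil.
apply: vsmooth_at_eq (vsmooth_at_add (sX i) IH).
by apply: nearW => q; rewrite big_cons.
Qed.

Definition coord_field c (a : 'rV[R]_n) : vfield M :=
  fun q => germ_op q (fun f => 'D_a (f \o cinv c) (cmap c q)).

Lemma vsmooth_coord_field c (a : 'rV[R]_n) p : matlas c -> cdom c p ->
  vsmooth_at p (coord_field c a).
Proof.
move=> ac dp; have [od _ _ _ _] := mcharts ac.
apply: vsmooth_atI; apply: (near_open od dp) => q dq; split.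
  exact: tangent_derive.
move=> f sf; have [D [oD Dq hD nD]] := smooth_at_chart ac dq sf.
have := smooth_at_comp (fun j => smooth_at_cmap j ac dq) nD (Cinf_derive a oD hD).
by apply: smooth_at_eq; apply: filterS (smooth_at_near sf) => q' sf';
  rewrite /coord_field germ_opE.
Qed.

Lemma tangent_coord c p v : matlas c -> cdom c p -> tangent p v ->
  v = \sum_j v (fun q => cmap c q ord0 j) *: coord_field c (delta_mx ord0 j) p.
Proof.
move=> ac dp tv; apply: (tangent_eq tv).
  apply: tangent_sum => j; apply: tangentZ; exact: tangent_derive.
move=> f sf; rewrite (tangent_chart ac dp tv sf) tvec_sumE.
by apply: eq_bigr => j _; rewrite -[RHS]/(_ * _) /coord_field germ_opE.
Qed.

(** A field with constant coefficients in a chart shows that the set from which [extend] chooses is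
    nonempty, so the choice is never the default. *)
Lemma extendP p v : tangent p v ->
  vsmooth_at p (extend p v) /\ extend p v p = v.
Proof.
move=> [c [ac dp [a ->]]].
have := @xgetPex _ (fun=> 0) [set X : vfield M | vsmooth_at p X /\
  X p = germ_op p (fun f => 'D_a (f \o cinv c) (cmap c p))].
by apply; exists (coord_field c a); split => //; exact: vsmooth_coord_field.
Qed.

Lemma lieE p X Y f : smooth_at p f ->
  lie X Y p f = X p (fun q => Y q f) - Y p (fun q => X q f).
Proof. exact: germ_opE. Qed.

End VectorFields.

(** * Bilinear algebra of a Riemannian metric *)

Section Metric.
Context {R : realType} {n : nat} {M : manifold R n}.
Variable g : M -> tvec M -> tvec M -> R.
Hypothesis hg : riemannian_metric g.
Implicit Types (p q : M) (u v w : tvec M) (X Y Z : vfield M).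

Lemma metricC p u v : tangent p u -> tangent p v -> g p u v = g p v u.
Proof. by case: hg => _ h _ _; exact: h. Qed.

Lemma metric_lin p u v w (a : R) :
  tangent p u -> tangent p v -> tangent p w ->
  g p (a *: u + v) w = a * g p u w + g p v w.
Proof. by case: hg => h _ _ _; exact: h. Qed.

Lemma metricDl p u v w : tangent p u -> tangent p v -> tangent p w ->
  g p (u + v) w = g p u w + g p v w.
Proof. by move=> *; rewrite -[u in LHS]scale1r metric_lin // mul1r. Qed.

Lemma metric0l p w : tangent p w -> g p 0 w = 0.
Proof.
move=> tw; have t0 := tangent0 p.
apply: (@addrI _ (g p 0 w)); rewrite -metricDl //.
by rewrite !addr0.
Qed.

Lemma metricZl p u w (a : R) : tangent p u -> tangent p w ->
  g p (a *: u) w = a * g p u w.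
Proof.
move=> tu tw; have t0 := tangent0 p.
by rewrite -[_ *: _]addr0 metric_lin // metric0l // addr0.
Qed.

Lemma metricNl p u w : tangent p u -> tangent p w -> g p (- u) w = - g p u w.
Proof. by move=> *; rewrite -scaleN1r metricZl // mulN1r. Qed.

Lemma metricBl p u v w : tangent p u -> tangent p v -> tangent p w ->
  g p (u - v) w = g p u w - g p v w.
Proof. by move=> *; rewrite metricDl ?metricNl //; exact: tangentN. Qed.

Lemma metric_subDl p u v w x : tangent p u -> tangent p v -> tangent p w ->
  tangent p x -> g p (u - v + w) x = g p u x - g p v x + g p w x.
Proof.
by move=> *; rewrite metricDl ?metricBl //; exact: tangentB.
Qed.

Lemma metric_suml p (I : Type) (s : seq I) (F : I -> tvec M) w :
  (forall i, tangent p (F i)) -> tangent p w ->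
  g p (\sum_(i <- s) F i) w = \sum_(i <- s) g p (F i) w.
Proof.
move=> tF tw; elim: s => [|i s IH]; first by rewrite !big_nil metric0l.
by rewrite !big_cons metricDl ?IH //; exact: tangent_sum.
Qed.

Lemma metricDr p u v w : tangent p u -> tangent p v -> tangent p w ->
  g p w (u + v) = g p w u + g p w v.
Proof.
move=> tu tv tw; rewrite (metricC tw (tangentD tu tv)) metricDl //.
by rewrite !(metricC _ tw).
Qed.

Lemma metric0r p w : tangent p w -> g p w 0 = 0.
Proof. by move=> tw; rewrite metricC ?metric0l //; exact: tangent0. Qed.

Lemma metricZr p u w (a : R) : tangent p u -> tangent p w ->
  g p w (a *: u) = a * g p w u.
Proof.
by move=> tu tw; rewrite (metricC tw (tangentZ a tu)) metricZl // (metricC tu).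
Qed.

Lemma metricNr p u w : tangent p u -> tangent p w -> g p w (- u) = - g p w u.
Proof. by move=> *; rewrite -scaleN1r metricZr // mulN1r. Qed.

Lemma metricBr p u v w : tangent p u -> tangent p v -> tangent p w ->
  g p w (u - v) = g p w u - g p w v.
Proof. by move=> *; rewrite metricDr ?metricNr //; exact: tangentN. Qed.

Lemma metric_sqrB p u v (a : R) : tangent p u -> tangent p v ->
  g p (u - a *: v) (u - a *: v) =
  g p u u - 2 * a * g p u v + a ^+ 2 * g p v v.
Proof.
move=> tu tv; have tav := tangentZ a tv; have tuv := tangentB tu tav.
rewrite metricBl // !metricBr // !metricZl // !metricZr // (metricC tv tu).
by ring.
Qed.

Lemma metric_sumr p (I : Type) (s : seq I) (F : I -> tvec M) w :
  (forall i, tangent p (F i)) -> tangent p w ->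
  g p w (\sum_(i <- s) F i) = \sum_(i <- s) g p w (F i).
Proof.
move=> tF tw; rewrite metricC ?metric_suml //; last exact: tangent_sum.
by apply: eq_bigr => i _; rewrite metricC.
Qed.

Lemma metric_eq0 p u : tangent p u -> g p u u = 0 -> u = 0.
Proof.
move=> tu gu; apply: contrapT => /eqP u0; case: hg => _ _ h _.
by have := h p u tu u0; rewrite gu ltxx.
Qed.

Lemma metric_ge0 p u : tangent p u -> 0 <= g p u u.
Proof.
move=> tu; have [->|u0] := eqVneq u 0.
  by rewrite metric0l //; exact: tangent0.
by case: hg => _ _ h _; exact/ltW/h.
Qed.

Lemma smooth_at_metric p X Y : vsmooth_at p X -> vsmooth_at p Y ->
  smooth_at p (fun q => g q (X q) (Y q)).
Proof.
move=> sX sY.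
have [W [oW Wp h]] :=
  near_openP (filterI (vsmooth_at_near sX) (vsmooth_at_near sY)).
exists W; split=> //.
by case: hg => _ _ _; apply=> //; apply: vsmooth_on_at => q /h[].
Qed.

End Metric.

(** * Locality and linearity of a connection *)

Section Connection.
Context {R : realType} {n : nat} {M : manifold R n}.
Variable nabla : M -> tvec M -> vfield M -> tvec M.
Hypothesis hD : connection nabla.
Implicit Types (p q : M) (u v w : tvec M) (X Y Z : vfield M).

Lemma nabla_tangent p v Y : tangent p v -> vsmooth_at p Y ->
  tangent p (nabla p v Y).
Proof. by case: hD => h _ _ _ _; exact: h. Qed.

Lemma nabla_scale p v f Y : tangent p v -> smooth_at p f -> vsmooth_at p Y ->
  nabla p v (fun q => f q *: Y q) = v f *: Y p + f p *: nabla p v Y.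
Proof. by case: hD => _ _ _ h _; exact: h. Qed.

Lemma nablaD p v Y Z : tangent p v -> vsmooth_at p Y -> vsmooth_at p Z ->
  nabla p v (fun q => Y q + Z q) = nabla p v Y + nabla p v Z.
Proof. by case: hD => _ _ h _ _; exact: h. Qed.

Lemma vsmooth_at_nabla p X Y : vsmooth_at p X -> vsmooth_at p Y ->
  vsmooth_at p (fun q => nabla q (X q) Y).
Proof.
move=> sX sY.
have [W [oW Wp h]] :=
  near_openP (filterI (vsmooth_at_near sX) (vsmooth_at_near sY)).
exists W; split=> //.
by case: hD => _ _ _ _; apply=> //; apply: vsmooth_on_at => q /h[].
Qed.

(* Multiplying by the indicator function of a neighbourhood, which is smooth  *)
(* at p, turns two fields that agree near p into equal total functions.       *)
Lemma nabla_near p v Y Z : tangent p v -> vsmooth_at p Y ->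
  (\forall q \near p, Y q = Z q) -> nabla p v Y = nabla p v Z.
Proof.
move=> tv sY YZ; have sZ := vsmooth_at_eq YZ sY.
have [W [oW Wp hW]] := near_openP YZ.
pose f (q : M) : R := if `[< W q >] then 1 else 0.
have f1 : \forall q \near p, f q = 1.
  by apply: (near_open oW Wp) => q Wq; rewrite /f asboolT.
have sf : smooth_at p f.
  by apply: smooth_at_eq (smooth_at_cst p 1); apply: filterS f1.
have fV V : vsmooth_at p V -> nabla p v (fun q => f q *: V q) = nabla p v V.
  move=> sV; rewrite nabla_scale // (tangent_near0 tv f1) scale0r add0r.
  by rewrite (nbhs_singleton f1) scale1r.
rewrite -(fV Y) // -(fV Z) //; congr nabla; apply/funext => q.
rewrite /f; have [/hW->//|nW] := pselect (W q).
by rewrite asboolF // !scale0r.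
Qed.

Lemma nabla_lin p u v (a : R) Y : tangent p u -> tangent p v -> vsmooth_at p Y ->
  nabla p (a *: u + v) Y = a *: nabla p u Y + nabla p v Y.
Proof. by case: hD => _ h _ _ _; exact: h. Qed.

Lemma nablaDl p u v Y : tangent p u -> tangent p v -> vsmooth_at p Y ->
  nabla p (u + v) Y = nabla p u Y + nabla p v Y.
Proof. by move=> *; rewrite -[u in LHS]scale1r nabla_lin // scale1r. Qed.

Lemma nabla0l p Y : vsmooth_at p Y -> nabla p 0 Y = 0.
Proof.
move=> sY; have t0 := tangent0 p.
apply: (@addrI _ (nabla p 0 Y)); rewrite -nablaDl //.
by rewrite !addr0.
Qed.

Lemma nablaZl p u (a : R) Y : tangent p u -> vsmooth_at p Y ->
  nabla p (a *: u) Y = a *: nabla p u Y.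
Proof.
move=> tu sY; have t0 := tangent0 p.
by rewrite -[a *: u]addr0 nabla_lin // nabla0l // addr0.
Qed.

Lemma nablaBl p u v Y : tangent p u -> tangent p v -> vsmooth_at p Y ->
  nabla p (u - v) Y = nabla p u Y - nabla p v Y.
Proof.
move=> tu tv sY; rewrite addrC -scaleN1r nabla_lin // scaleN1r addrC.
by [].
Qed.

Lemma nabla_suml p (I : Type) (s : seq I) (F : I -> tvec M) Y :
  (forall i, tangent p (F i)) -> vsmooth_at p Y ->
  nabla p (\sum_(i <- s) F i) Y = \sum_(i <- s) nabla p (F i) Y.
Proof.
move=> tF sY; elim: s => [|i s IH]; first by rewrite !big_nil nabla0l.
by rewrite !big_cons nablaDl ?IH //; exact: tangent_sum.
Qed.

Lemma nabla0 p v : tangent p v -> nabla p v (fun=> 0) = 0.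
Proof.
move=> tv; apply: (@addrI _ (nabla p v (fun=> 0))).
rewrite -nablaD //; [|exact: vsmooth_at0|exact: vsmooth_at0].
by rewrite !addr0.
Qed.

Lemma nabla_sum p v (I : Type) (s : seq I) (F : I -> vfield M) :
  (forall i, vsmooth_at p (F i)) -> tangent p v ->
  nabla p v (fun q => \sum_(i <- s) F i q) = \sum_(i <- s) nabla p v (F i).
Proof.
move=> sF tv; elim: s => [|i s IH].
  rewrite big_nil -[RHS](nabla0 tv); congr nabla; apply/funext => q.
  by rewrite big_nil.
rewrite big_cons -IH -nablaD //; last exact: vsmooth_at_sum.
by congr nabla; apply/funext => q; rewrite big_cons.
Qed.

End Connection.

(** * The Levi-Civita connection and the Koszul formula *)

Section LeviCivita.
Context {R : realType} {n : nat} {M : manifold R n}.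
Variable g : M -> tvec M -> tvec M -> R.
Variable nabla : M -> tvec M -> vfield M -> tvec M.
Hypothesis hg : riemannian_metric g.
Hypothesis hLC : levi_civita g nabla.
Implicit Types (p q : M) (u v w : tvec M) (X Y Z : vfield M).

Let hD : connection nabla. Proof. by case: hLC. Qed.

Lemma nabla_torsion p X Y : vsmooth_at p X -> vsmooth_at p Y ->
  lie X Y p = nabla p (X p) Y - nabla p (Y p) X.
Proof. by case: hLC => _ h _ sX sY; rewrite h. Qed.

Lemma tangent_lie p X Y : vsmooth_at p X -> vsmooth_at p Y ->
  tangent p (lie X Y p).
Proof.
move=> sX sY; rewrite nabla_torsion //.
by apply: tangentB; apply: nabla_tangent => //; exact: vsmooth_at_tangent.
Qed.

Lemma vsmooth_at_lie p X Y : vsmooth_at p X -> vsmooth_at p Y ->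
  vsmooth_at p (lie X Y).
Proof.
move=> sX sY; have := vsmooth_at_sub (vsmooth_at_nabla hD sX sY)
  (vsmooth_at_nabla hD sY sX); apply: vsmooth_at_eq.
apply: filterS2 (vsmooth_at_near sX) (vsmooth_at_near sY) => q hX hY.
by rewrite nabla_torsion.
Qed.

Lemma metric_compat p v Y Z : tangent p v -> vsmooth_at p Y -> vsmooth_at p Z ->
  v (fun q => g q (Y q) (Z q)) = g p (nabla p v Y) (Z p) + g p (Y p) (nabla p v Z).
Proof. by case: hLC => _ _; exact. Qed.

(** The source of every skew-symmetry below: the constant is 0 for a vertical against a horizontal
    field, and a Kronecker delta for two frame fields. *)
Lemma metric_compat_const p v Y Z (a : R) :
  tangent p v -> vsmooth_at p Y -> vsmooth_at p Z ->
  (\forall q \near p, g q (Y q) (Z q) = a) ->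
  g p (nabla p v Y) (Z p) = - g p (Y p) (nabla p v Z).
Proof.
move=> tv sY sZ YZ; apply/eqP; rewrite -addr_eq0 -metric_compat //.
by rewrite (tangent_near0 tv YZ).
Qed.

(** The right-hand side is expanded by metric compatibility and vanishing torsion. The formula
    determines the connection from the metric and the brackets, which is how the connections of [M]
    and [N] are compared on lifts. *)
Lemma koszul p X Y Z : vsmooth_at p X -> vsmooth_at p Y -> vsmooth_at p Z ->
  2 * g p (nabla p (X p) Y) (Z p) =
    X p (fun q => g q (Y q) (Z q)) + Y p (fun q => g q (X q) (Z q))
    - Z p (fun q => g q (X q) (Y q))
    + g p (lie X Y p) (Z p) - g p (lie X Z p) (Y p) - g p (lie Y Z p) (X p).
Proof.
move=> sX sY sZ.
have tX := vsmooth_at_tangent sX; have tY := vsmooth_at_tangent sY.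
have tZ := vsmooth_at_tangent sZ.
rewrite (metric_compat tX sY sZ) (metric_compat tY sX sZ) (metric_compat tZ sX sY).
rewrite !nabla_torsion // !(metricBl hg) //; try exact: nabla_tangent.
rewrite (metricC hg (nabla_tangent hD tX sZ) tY).
rewrite (metricC hg (nabla_tangent hD tY sZ) tX).
rewrite (metricC hg (nabla_tangent hD tZ sY) tX).
by ring.
Qed.

End LeviCivita.

(** * Submersions *)

(* all_analysis shadows this name with the pushforward of measures. *)
Local Notation pushforward := Defs.pushforward.

(** * Pullback of functions, pushforward of vectors, related fields *)

Section SmoothMaps.
Context {R : realType} {m n : nat} {M : manifold R m} {N : manifold R n}.
Variable pi : M -> N.
Hypothesis spi : smooth_map pi.
Implicit Types (p q : M) (u v : tvec M) (X Y Z : vfield M).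

Lemma near_pull p (P : N -> Prop) : (\forall y \near pi p, P y) ->
  \forall q \near p, P (pi q).
Proof. by case: spi => cpi _ nP; exact: (cpi p P nP). Qed.

Lemma smooth_at_pull_cmap p c j : matlas c -> cdom c (pi p) ->
  smooth_at p (fun q => cmap c (pi q) ord0 j).
Proof.
case: spi => cpi hpi ac dp; have [od _ _ _ _] := mcharts ac.
exists (pi @^-1` cdom c); split=> //; last exact: hpi.
by apply: open_comp => // q _; exact: cpi.
Qed.

Lemma smooth_at_pull p f : smooth_at (pi p) f -> smooth_at p (f \o pi).
Proof.
move=> sf; have [c ac dp] := mcover (pi p).
have [D [_ _ hD nD]] := smooth_at_chart ac dp sf.
have := smooth_at_comp (fun j => smooth_at_pull_cmap j ac dp) (near_pull nD) hD.
apply: smooth_at_eq; exact: (near_pull (near_chartK f ac dp)).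
Qed.

Lemma pushforwardE p v f : smooth_at (pi p) f ->
  pushforward pi p v f = v (f \o pi).
Proof. exact: germ_opE. Qed.

Lemma pushforward_tangent p v : tangent p v -> tangent (pi p) (pushforward pi p v).
Proof.
move=> tv; have [c ac dp] := mcover (pi p).
apply: (tangentI ac dp) => f sf; first exact: germ_op0.
have [D [_ _ hD nD]] := smooth_at_chart ac dp sf.
rewrite pushforwardE //.
have -> : v (f \o pi) = v ((f \o cinv c) \o (cmap c \o pi)).
  apply: (tangent_near tv).
  by apply: filterS (near_pull (near_chartK f ac dp)) => q /= ->.
rewrite (tangent_comp tv _ (near_pull nD) hD) //; last first.
  by move=> j; exact: smooth_at_pull_cmap.
apply: eq_bigr => j _; rewrite pushforwardE //; exact: smooth_at_cmap.
Qed.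

Lemma pushforward_lin p u v (a : R) :
  pushforward pi p (a *: u + v) = a *: pushforward pi p u + pushforward pi p v.
Proof.
apply/funext => f.
rewrite -[RHS]/(a * pushforward pi p u f + pushforward pi p v f).
have [sf|nf] := pselect (smooth_at (pi p) f); first by rewrite !pushforwardE.
by rewrite /Defs.pushforward !germ_op0 // mulr0 addr0.
Qed.

Lemma pushforward0 p : pushforward pi p 0 = 0.
Proof.
apply/funext => f; have [sf|nf] := pselect (smooth_at (pi p) f).
  by rewrite pushforwardE.
by rewrite /Defs.pushforward !germ_op0.
Qed.

Lemma pushforwardD p u v :
  pushforward pi p (u + v) = pushforward pi p u + pushforward pi p v.
Proof. by rewrite -[u in LHS]scale1r pushforward_lin scale1r. Qed.

Lemma pushforwardZ p u (a : R) :
  pushforward pi p (a *: u) = a *: pushforward pi p u.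
Proof.
by rewrite -[_ *: u]addr0 pushforward_lin pushforward0 addr0.
Qed.

Lemma pushforwardB p u v :
  pushforward pi p (u - v) = pushforward pi p u - pushforward pi p v.
Proof. by rewrite pushforwardD -scaleN1r pushforwardZ scaleN1r. Qed.

(** Relatedness of germs: it is required near [p] and not only at [p], because brackets
    differentiate the fields. *)
Definition related p X (X' : vfield N) : Prop :=
  \forall q \near p, pushforward pi q (X q) = X' (pi q).

Lemma pushforward_lie p X Y (X' Y' : vfield N) :
  vsmooth_at p X -> vsmooth_at p Y ->
  vsmooth_at (pi p) X' -> vsmooth_at (pi p) Y' ->
  related p X X' -> related p Y Y' ->
  pushforward pi p (lie X Y p) = lie X' Y' (pi p).
Proof.
(* Iterated derivatives of [f \o pi] along related fields equal those of [f] on the base; a bracket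
   is a difference of two of them. *)
have step (Z V : vfield M) (Z' V' : vfield N) f :
    vsmooth_at p Z -> vsmooth_at (pi p) V' -> related p Z Z' -> related p V V' -> smooth_at (pi p) f ->
    Z p (fun q => V q (f \o pi)) = Z' (pi p) (fun y => V' y f).
  move=> sZ sV' rZ rV sf; rewrite -(nbhs_singleton rZ) pushforwardE.
    apply: (tangent_near (vsmooth_at_tangent sZ)).
    have nf := near_pull (smooth_at_near sf).
    apply: filterS2 rV nf => q Vq sfq.
    by rewrite /= -Vq pushforwardE.
  exact: vsmooth_at_app.
move=> sX sY sX' sY' rX rY; apply/funext => f.
have [sf|nf] := pselect (smooth_at (pi p) f); last first.
  by rewrite /Defs.pushforward /lie !germ_op0.
rewrite pushforwardE // !lieE //; last exact: smooth_at_pull.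
by rewrite (step _ _ _ _ _ sX sY' rX rY sf) (step _ _ _ _ _ sY sX' rY rX sf).
Qed.

End SmoothMaps.

(** * Vertical and horizontal vectors, and the projections in an adapted frame *)

Section Submersion.
Context {R : realType} {m n : nat} {M : manifold R m} {N : manifold R n}.
Variables (gM : M -> tvec M -> tvec M -> R) (gN : N -> tvec N -> tvec N -> R).
Variables (nabla : M -> tvec M -> vfield M -> tvec M).
Variables (nablaN : N -> tvec N -> vfield N -> tvec N).
Variable pi : M -> N.
Hypothesis hgM : riemannian_metric gM.
Hypothesis hgN : riemannian_metric gN.
Hypothesis hLC : levi_civita gM nabla.
Hypothesis hLCN : levi_civita gN nablaN.
Hypothesis hpi : riemannian_submersion gM gN pi.
Variables (r l : nat) (U : 'I_r -> vfield M) (X : 'I_l -> vfield M).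
Variable W : set M.
Hypothesis oW : open W.
Hypothesis hF : adapted_frame gM pi U X W.
Implicit Types (p q : M) (u v w x y : tvec M) (V Y Z : vfield M).

Local Notation vproj := (vproj gM pi).
Local Notation hproj := (hproj gM pi).
Local Notation vpart := (vpart gM pi).
Local Notation hpart := (hpart gM pi).
Local Notation vertical := (vertical pi).
Local Notation horizontal := (horizontal gM pi).
Local Notation push := (pushforward pi).

Let spi : smooth_map pi. Proof. by case: hpi. Qed.
Let hD : connection nabla. Proof. by case: hLC. Qed.
Let hDN : connection nablaN. Proof. by case: hLCN. Qed.

Lemma vertical_tangent p v : vertical p v -> tangent p v. Proof. by case. Qed.
Lemma horizontal_tangent p v : horizontal p v -> tangent p v. Proof. by case. Qed.
Local Hint Resolve vertical_tangent horizontal_tangent : core.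

Lemma vertical_lin p u v (a : R) : vertical p u -> vertical p v ->
  vertical p (a *: u + v).
Proof.
move=> [tu u0] [tv v0]; split; first exact: tangent_lin.
by rewrite pushforward_lin u0 v0 scaler0 addr0.
Qed.

Lemma vertical0 p : vertical p 0.
Proof. by split; [exact: tangent0 | exact: pushforward0]. Qed.

Lemma verticalD p u v : vertical p u -> vertical p v -> vertical p (u + v).
Proof. by move=> *; rewrite -[u]scale1r; exact: vertical_lin. Qed.

Lemma verticalZ p u (a : R) : vertical p u -> vertical p (a *: u).
Proof.
by move=> *; rewrite -[_ *: u]addr0; apply: vertical_lin => //; exact: vertical0.
Qed.

Lemma verticalB p u v : vertical p u -> vertical p v -> vertical p (u - v).
Proof. by move=> *; rewrite addrC -scaleN1r; exact: vertical_lin. Qed.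

Lemma vertical_sum p (I : Type) (s : seq I) (F : I -> tvec M) :
  (forall i, vertical p (F i)) -> vertical p (\sum_(i <- s) F i).
Proof.
move=> tF; elim/big_ind: _ => //; [exact: vertical0 | move=> *; exact: verticalD].
Qed.

Lemma horizontal_lin p u v (a : R) : horizontal p u -> horizontal p v ->
  horizontal p (a *: u + v).
Proof.
move=> [tu hu] [tv hv]; split=> [|w vw]; first exact: tangent_lin.
have tw := vertical_tangent vw.
rewrite (metricDr hgM) ?(metricZr hgM) ?hu ?hv ?mulr0 ?addr0 //.
exact: tangentZ.
Qed.

Lemma horizontal0 p : horizontal p 0.
Proof.
by split=> [|u vu]; [exact: tangent0 | rewrite (metric0r hgM) //; case: vu].
Qed.

Lemma horizontalB p u v : horizontal p u -> horizontal p v ->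
  horizontal p (u - v).
Proof. by move=> *; rewrite addrC -scaleN1r; exact: horizontal_lin. Qed.

Lemma horizontalZ p u (a : R) : horizontal p u -> horizontal p (a *: u).
Proof.
by move=> *; rewrite -[_ *: u]addr0; apply: horizontal_lin => //; exact: horizontal0.
Qed.

Lemma horizontal_sum p (I : Type) (s : seq I) (F : I -> tvec M) :
  (forall i, horizontal p (F i)) -> horizontal p (\sum_(i <- s) F i).
Proof.
move=> tF; elim/big_ind: _ => //; first exact: horizontal0.
by move=> *; rewrite -[X in X + _]scale1r; exact: horizontal_lin.
Qed.

Lemma metric_vh p u x : vertical p u -> horizontal p x -> gM p u x = 0.
Proof. by move=> vu [_]; exact. Qed.

Lemma metric_hv p u x : vertical p u -> horizontal p x -> gM p x u = 0.
Proof. by move=> vu hx; rewrite (metricC hgM) // ?metric_vh //; auto. Qed.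

Lemma vertical_horizontal0 p u : vertical p u -> horizontal p u -> u = 0.
Proof. by move=> vu hu; apply: (metric_eq0 hgM) (metric_vh vu hu); auto. Qed.

Section AtPoint.
Context (p : M) (Wp : W p).

Let vU k : vertical p (U k p).
Proof. by case: hF => _ _ /(_ p Wp) [h _] _ _; exact: h. Qed.
Let hX i : horizontal p (X i p).
Proof. by case: hF => _ _ /(_ p Wp) [_ h] _ _; exact: h. Qed.
Let gU k h : gM p (U k p) (U h p) = (k == h)%:R.
Proof. by case: hF => _ _ _ /(_ p Wp) [e _] _; exact: e. Qed.
Let gX i j : gM p (X i p) (X j p) = (i == j)%:R.
Proof. by case: hF => _ _ _ /(_ p Wp) [_ e] _; exact: e. Qed.

Let tU k : tangent p (U k p). Proof. by case: (vU k). Qed.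
Let tX i : tangent p (X i p). Proof. by case: (hX i). Qed.

Lemma vertical_expand u : vertical p u ->
  u = \sum_k gM p u (U k p) *: U k p.
Proof.
move=> vu; case: hF => _ _ _ _ /(_ p Wp) [h _]; have [t ut] := h u vu.
rewrite {1}ut; apply: eq_bigr => k _; congr (_ *: _).
rewrite ut (metric_suml hgM) //; last by move=> h'; exact: tangentZ.
rewrite (bigD1 k) //= (metricZl hgM) ?gU ?eqxx ?mulr1; auto.
rewrite big1 ?addr0 // => h' h'k; rewrite (metricZl hgM) ?gU; auto.
by rewrite (negPf h'k) mulr0.
Qed.

Lemma horizontal_expand x : horizontal p x ->
  x = \sum_i gM p x (X i p) *: X i p.
Proof.
move=> hx; case: hF => _ _ _ _ /(_ p Wp) [_ h]; have [t xt] := h x hx.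
rewrite {1}xt; apply: eq_bigr => i _; congr (_ *: _).
rewrite xt (metric_suml hgM) //; last by move=> h'; exact: tangentZ.
rewrite (bigD1 i) //= (metricZl hgM) ?gX ?eqxx ?mulr1; auto.
rewrite big1 ?addr0 // => h' h'k; rewrite (metricZl hgM) ?gX; auto.
by rewrite (negPf h'k) mulr0.
Qed.

Lemma vproj_spec v : tangent p v ->
  vertical p (\sum_k gM p v (U k p) *: U k p) /\
  horizontal p (v - \sum_k gM p v (U k p) *: U k p).
Proof.
move=> tv; set s := \sum_k _.
have vs : vertical p s by apply: vertical_sum => k; exact: verticalZ.
split=> //; split; first by apply: tangentB => //; auto.
move=> u vu; have ts := vertical_tangent vs.
have tvs : tangent p (v - s) by exact: tangentB.
have gUs k : gM p (U k p) (v - s) = 0.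
  rewrite (metricBr hgM) //; auto.
  rewrite (metric_sumr hgM); auto.
  - rewrite (bigD1 k) //= (metricZr hgM) ?gU ?eqxx ?mulr1; auto.
    rewrite big1 ?addr0 ?(metricC hgM (vertical_tangent (vU k)) tv) ?subrr //.
    move=> h hk; rewrite (metricZr hgM) ?gU; auto.
    by rewrite eq_sym (negPf hk) mulr0.
  - by move=> h; apply: tangentZ; auto.
rewrite (vertical_expand vu) (metric_suml hgM) //.
  by rewrite big1 // => k _; rewrite (metricZl hgM) ?gUs ?mulr0; auto.
by move=> k; apply: tangentZ; auto.
Qed.

(** [vproj] is a choice, pinned down by uniqueness: two decompositions differ by a vector that is
    both vertical and horizontal, hence orthogonal to itself. *)
Lemma vprojE v : tangent p v -> vproj p v = \sum_k gM p v (U k p) *: U k p.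
Proof.
move=> tv; have [vs hs] := vproj_spec tv; set s := \sum_k _ in vs hs *.
have [v1 h1] : vertical p (vproj p v) /\ horizontal p (v - vproj p v).
  have := @xgetPex _ 0 [set u | vertical p u /\ horizontal p (v - u)].
  by apply; exists s.
apply/eqP; rewrite -subr_eq0; apply/eqP/(@vertical_horizontal0 p).
  exact: verticalB.
by rewrite (_ : _ - s = (v - s) - (v - vproj p v)); [exact: horizontalB | ring].
Qed.

Lemma vproj_vertical v : tangent p v -> vertical p (vproj p v).
Proof. by move=> tv; rewrite vprojE //; case: (vproj_spec tv). Qed.

Lemma hproj_horizontal v : tangent p v -> horizontal p (hproj p v).
Proof. by move=> tv; rewrite /Defs.hproj vprojE //; case: (vproj_spec tv). Qed.

Lemma vproj_hproj v : vproj p v + hproj p v = v.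
Proof. by rewrite /Defs.hproj addrC subrK. Qed.

Lemma vproj_id u : vertical p u -> vproj p u = u.
Proof. by move=> vu; rewrite vprojE -?vertical_expand; auto. Qed.

Lemma hproj_vertical0 u : vertical p u -> hproj p u = 0.
Proof. by move=> vu; rewrite /Defs.hproj vproj_id // subrr. Qed.

Lemma vproj_horizontal0 x : horizontal p x -> vproj p x = 0.
Proof.
move=> hx; rewrite vprojE; auto.
by rewrite big1 // => k _; rewrite metric_hv // scale0r.
Qed.

Lemma hproj_id x : horizontal p x -> hproj p x = x.
Proof. by move=> hx; rewrite /Defs.hproj vproj_horizontal0 // subr0. Qed.

Lemma metric_vproj v u : tangent p v -> vertical p u ->
  gM p v u = gM p (vproj p v) u.
Proof.
move=> tv vu; have vv := vproj_vertical tv; have hv := hproj_horizontal tv.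
rewrite -{1}(vproj_hproj v) (metricDl hgM); auto.
by rewrite (metric_hv vu hv) addr0.
Qed.

Lemma metric_hproj v x : tangent p v -> horizontal p x ->
  gM p v x = gM p (hproj p v) x.
Proof.
move=> tv hx; have vv := vproj_vertical tv; have hv := hproj_horizontal tv.
rewrite -{1}(vproj_hproj v) (metricDl hgM); auto.
by rewrite (metric_vh vv hx) add0r.
Qed.

Lemma vproj_lin u v (a : R) : tangent p u -> tangent p v ->
  vproj p (a *: u + v) = a *: vproj p u + vproj p v.
Proof.
move=> tu tv; rewrite !vprojE //; last exact: tangent_lin.
rewrite scaler_sumr -big_split; apply: eq_bigr => k _ /=.
by rewrite (metric_lin hgM) // scalerDl scalerA.
Qed.

Lemma vprojD u v : tangent p u -> tangent p v ->
  vproj p (u + v) = vproj p u + vproj p v.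
Proof. by move=> *; rewrite -[u in LHS]scale1r vproj_lin // scale1r. Qed.

Lemma vprojB u v : tangent p u -> tangent p v ->
  vproj p (u - v) = vproj p u - vproj p v.
Proof. by move=> *; rewrite addrC -scaleN1r vproj_lin // scaleN1r addrC. Qed.

Lemma vproj0 : vproj p 0 = 0. Proof. exact/vproj_id/vertical0. Qed.
Lemma hproj0 : hproj p 0 = 0. Proof. exact/hproj_id/horizontal0. Qed.

Lemma vprojZ u (a : R) : tangent p u -> vproj p (a *: u) = a *: vproj p u.
Proof.
move=> tu; have t0 := tangent0 p.
by rewrite -[a *: u]addr0 vproj_lin // vproj0 addr0.
Qed.

Lemma metric_push x y : horizontal p x -> horizontal p y ->
  gN (pi p) (push p x) (push p y) = gM p x y.
Proof. by case: hpi => _ _ _ _; exact. Qed.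

Lemma push_hproj v : tangent p v -> push p (hproj p v) = push p v.
Proof.
move=> tv; rewrite -[v in RHS]vproj_hproj pushforwardD.
by have [_ ->] := vproj_vertical tv; rewrite add0r.
Qed.

Lemma metric_push_hproj v x : tangent p v -> horizontal p x ->
  gM p v x = gN (pi p) (push p v) (push p x).
Proof.
move=> tv hx; rewrite metric_hproj // -metric_push //; last exact: hproj_horizontal.
by rewrite push_hproj.
Qed.

Lemma push_inj x y : horizontal p x -> horizontal p y -> push p x = push p y ->
  x = y.
Proof.
move=> hx hy xy; apply/eqP; rewrite -subr_eq0; apply/eqP.
have hxy := horizontalB hx hy; apply: (@vertical_horizontal0 p) => //.
by split; [case: hxy | rewrite pushforwardB xy subrr].
Qed.

Lemma horizontal_lift (w : tvec N) : tangent (pi p) w ->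
  exists2 x, horizontal p x & push p x = w.
Proof.
case: hpi => _ _ _ h _ /h [v tv <-].
by exists (hproj p v); [exact: hproj_horizontal | exact: push_hproj].
Qed.

Lemma horizontal_eq x y : horizontal p x -> horizontal p y ->
  (forall z, horizontal p z -> gM p x z = gM p y z) -> x = y.
Proof.
move=> hx hy xy; apply/eqP; rewrite -subr_eq0; apply/eqP.
have hxy := horizontalB hx hy.
apply: (metric_eq0 hgM (horizontal_tangent hxy)).
by rewrite (metricBl hgM) ?xy ?subrr; auto.
Qed.

End AtPoint.


Definition vertical_near p V := \forall q \near p, vertical q (V q).
Definition horizontal_near p Y := \forall q \near p, horizontal q (Y q).

Lemma near_frame p : W p -> \forall q \near p, W q.
Proof. by move=> Wp; apply: (near_open oW Wp). Qed.

Lemma vsmooth_U p k : W p -> vsmooth_at p (U k).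
Proof. by case: hF => h _ _ _ _; exact: (vsmooth_onP _ oW).1. Qed.

Lemma vsmooth_X p i : W p -> vsmooth_at p (X i).
Proof. by case: hF => _ h _ _ _; exact: (vsmooth_onP _ oW).1. Qed.

Lemma vertical_U p k : W p -> vertical p (U k p).
Proof. by move=> Wp; case: hF => _ _ /(_ p Wp) [h _] _ _; exact: h. Qed.

Lemma horizontal_X p i : W p -> horizontal p (X i p).
Proof. by move=> Wp; case: hF => _ _ /(_ p Wp) [_ h] _ _; exact: h. Qed.

Lemma vertical_near_U p k : W p -> vertical_near p (U k).
Proof. by move=> /near_frame; apply: filterS => q; exact: vertical_U. Qed.

Lemma horizontal_near_X p i : W p -> horizontal_near p (X i).
Proof. by move=> /near_frame; apply: filterS => q; exact: horizontal_X. Qed.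

Lemma vsmooth_vpart p Y : W p -> vsmooth_at p Y -> vsmooth_at p (vpart Y).
Proof.
move=> Wp sY.
have : vsmooth_at p (fun q => \sum_k gM q (Y q) (U k q) *: U k q).
  apply: vsmooth_at_sum => k; apply: vsmooth_at_scale; last exact: vsmooth_U.
  by apply: smooth_at_metric => //; exact: vsmooth_U.
apply: vsmooth_at_eq; apply: filterS2 (near_frame Wp) (vsmooth_at_near sY).
by move=> q Wq sq; rewrite /Defs.vpart vprojE //; exact: vsmooth_at_tangent.
Qed.

Lemma vsmooth_hpart p Y : W p -> vsmooth_at p Y -> vsmooth_at p (hpart Y).
Proof. by move=> Wp sY; apply: vsmooth_at_sub => //; exact: vsmooth_vpart. Qed.

Lemma vertical_near_vpart p Y : W p -> vsmooth_at p Y -> vertical_near p (vpart Y).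
Proof.
move=> Wp sY; apply: filterS2 (near_frame Wp) (vsmooth_at_near sY) => q Wq sq.
by apply: vproj_vertical => //; exact: vsmooth_at_tangent.
Qed.

Lemma horizontal_near_hpart p Y : W p -> vsmooth_at p Y ->
  horizontal_near p (hpart Y).
Proof.
move=> Wp sY; apply: filterS2 (near_frame Wp) (vsmooth_at_near sY) => q Wq sq.
by apply: hproj_horizontal => //; exact: vsmooth_at_tangent.
Qed.

Lemma nabla_vpart_hpart p v Y : W p -> tangent p v -> vsmooth_at p Y ->
  nabla p v Y = nabla p v (vpart Y) + nabla p v (hpart Y).
Proof.
move=> Wp tv sY.
rewrite -(nablaD hD) //; [|exact: vsmooth_vpart|exact: vsmooth_hpart].
by congr (nabla _ _ _); apply/funext => q; rewrite vproj_hproj.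
Qed.

Lemma metric_near_vh p V Y : vertical_near p V -> horizontal_near p Y ->
  \forall q \near p, gM q (V q) (Y q) = 0.
Proof. by apply: filterS2 => q; exact: metric_vh. Qed.

Lemma metric_near_hv p V Y : vertical_near p V -> horizontal_near p Y ->
  \forall q \near p, gM q (Y q) (V q) = 0.
Proof. by apply: filterS2 => q; exact: metric_hv. Qed.

Lemma nabla_vh_skew p v V Y : tangent p v -> vsmooth_at p V -> vsmooth_at p Y ->
  vertical_near p V -> horizontal_near p Y ->
  gM p (nabla p v V) (Y p) = - gM p (V p) (nabla p v Y).
Proof.
move=> tv sV sY nV nY; apply: (metric_compat_const hLC) => //.
exact: metric_near_vh.
Qed.

Lemma nabla_hv_skew p v V Y : tangent p v -> vsmooth_at p V -> vsmooth_at p Y ->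
  vertical_near p V -> horizontal_near p Y ->
  gM p (nabla p v Y) (V p) = - gM p (Y p) (nabla p v V).
Proof.
move=> tv sV sY nV nY; apply: (metric_compat_const hLC) => //.
exact: metric_near_hv.
Qed.

(** A vertical field is related to the zero field, so the bracket pushes forward to [0, Y'] = 0. *)
Lemma lie_vertical p V Y (Y' : vfield N) :
  vsmooth_at p V -> vsmooth_at p Y -> vsmooth_at (pi p) Y' ->
  vertical_near p V -> related pi p Y Y' -> vertical p (lie V Y p).
Proof.
move=> sV sY sY' nV rY; split; first exact: (tangent_lie hLC).
have rV : related pi p V (fun=> 0 : tvec N) by apply: filterS nV => q [].
rewrite (pushforward_lie spi sV sY (vsmooth_at0 _) sY' rV rY).
apply/funext => f; rewrite /lie /germ_op; case: ifP => // _.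
rewrite -[X in X - _]/(0 : R) sub0r.
by rewrite [X in - X](tangent_cst _ (vsmooth_at_tangent sY')) oppr0.
Qed.

Lemma lie_verticals p V Z : vsmooth_at p V -> vsmooth_at p Z ->
  vertical_near p V -> vertical_near p Z -> vertical p (lie V Z p).
Proof.
move=> sV sZ nV nZ; apply: (lie_vertical sV sZ (vsmooth_at0 _) nV).
by apply: filterS nZ => q [].
Qed.

(** This is the symmetry of T: without torsion the two sides differ by the inner product of a
    bracket of vertical fields, again vertical, with a horizontal vector. *)
Lemma nabla_vertical_sym p V Z Y : vsmooth_at p V -> vsmooth_at p Z ->
  vertical_near p V -> vertical_near p Z -> horizontal p (Y p) ->
  gM p (nabla p (V p) Z) (Y p) = gM p (nabla p (Z p) V) (Y p).
Proof.
move=> sV sZ nV nZ hY; apply/eqP; rewrite -subr_eq0.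
have [tV tZ] := (vsmooth_at_tangent sV, vsmooth_at_tangent sZ).
rewrite -(metricBl hgM); try exact: nabla_tangent; last by auto.
by rewrite -(nabla_torsion hLC) // metric_vh //; exact: lie_verticals.
Qed.

(** * Horizontal lifts *)

(** The horizontal lift of a base field: the pushed frame vectors are orthonormal and span the
    tangent space of the base, so the coefficients are the coordinates of [Y'] there. *)
Definition lift (Y' : vfield N) : vfield M := fun q =>
  \sum_a gN (pi q) (Y' (pi q)) (push q (X a q)) *: X a q.

Lemma vsmooth_lift p (Y' : vfield N) : W p -> vsmooth_at (pi p) Y' ->
  vsmooth_at p (lift Y').
Proof.
move=> Wp sY'; apply: vsmooth_at_sum => a.
apply: vsmooth_at_scale; last exact: vsmooth_X.
have [c ac dp] := mcover (pi p); have [od _ _ _ _] := mcharts ac.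
pose E j : vfield N := coord_field c (delta_mx ord0 j).
have sE j : vsmooth_at (pi p) (E j) by exact: vsmooth_coord_field.
(* [push q (X a q)] depends on [q] and not only on [pi q], so it is no field on [N]; it is expanded
   in the coordinate fields [E j], with coefficients the derivatives of the pulled-back coordinates
   along [X a]. *)
have : smooth_at p (fun q => \sum_j X a q (fun q' => cmap c (pi q') ord0 j)
    * ((fun y : N => gN y (Y' y) (E j y)) \o pi) q).
  apply: smooth_at_sum => j; apply: smooth_at_mul.
    by apply: vsmooth_at_app; [exact: vsmooth_X | exact: smooth_at_pull_cmap].
  by apply: smooth_at_pull => //; exact: smooth_at_metric.
apply: smooth_at_eq.
have nc := near_pull spi (near_open od dp (fun (y : N) dy => dy)).
have nY := near_pull spi (vsmooth_at_near sY').
apply: filterS3 nc nY (near_frame Wp) => q dq sq Wq /=.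
have tX : tangent q (X a q) by exact: vsmooth_at_tangent (vsmooth_X _ Wq).
have tE j : tangent (pi q) (E j (pi q)) by exact: tangent_derive.
have tY := vsmooth_at_tangent sq.
rewrite [in RHS](tangent_coord ac dq (pushforward_tangent spi tX)).
rewrite (metric_sumr hgN); last 2 first.
- by move=> j; apply: tangentZ; exact: tE.
- exact: tY.
apply: eq_bigr => j _; rewrite (metricZr hgN _ (tE j) tY); congr (_ * _).
by rewrite pushforwardE //; exact: smooth_at_cmap.
Qed.

Lemma horizontal_lift_field p (Y' : vfield N) : W p -> horizontal p (lift Y' p).
Proof.
move=> Wp; apply: horizontal_sum => a; apply: horizontalZ; exact: horizontal_X.
Qed.

Lemma push_lift p (Y' : vfield N) : W p -> tangent (pi p) (Y' (pi p)) ->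
  push p (lift Y' p) = Y' (pi p).
Proof.
move=> Wp tY; have [x hx xY] := horizontal_lift Wp tY.
rewrite -xY; congr (push p _); rewrite [RHS](horizontal_expand Wp hx).
apply: eq_bigr => a _; congr (_ *: _).
by rewrite -xY metric_push //; exact: horizontal_X.
Qed.

Lemma lift_val p (Y' : vfield N) x : W p -> horizontal p x ->
  Y' (pi p) = push p x -> lift Y' p = x.
Proof.
move=> Wp hx Yx; have hl := horizontal_lift_field Y' Wp.
apply: (push_inj hl hx).
rewrite push_lift // Yx; apply: pushforward_tangent => //; auto.
Qed.

Lemma horizontal_near_lift p (Y' : vfield N) : W p -> horizontal_near p (lift Y').
Proof.
by move=> /near_frame; apply: filterS => q; exact: horizontal_lift_field.
Qed.

Lemma related_lift p (Y' : vfield N) : W p -> vsmooth_at (pi p) Y' ->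
  related pi p (lift Y') Y'.
Proof.
move=> Wp sY; have nY := near_pull spi (vsmooth_at_near sY).
apply: filterS2 (near_frame Wp) nY => q Wq sq; apply: push_lift => //.
exact: vsmooth_at_tangent.
Qed.

Lemma metric_lift p (Y' Z' : vfield N) : W p ->
  tangent (pi p) (Y' (pi p)) -> tangent (pi p) (Z' (pi p)) ->
  gM p (lift Y' p) (lift Z' p) = gN (pi p) (Y' (pi p)) (Z' (pi p)).
Proof.
move=> Wp tY tZ; rewrite -(push_lift Wp tY) -(push_lift Wp tZ) metric_push //;
  exact: horizontal_lift_field.
Qed.

Lemma lift_metric_derive p v (Y' Z' : vfield N) : W p -> tangent p v ->
  vsmooth_at (pi p) Y' -> vsmooth_at (pi p) Z' ->
  v (fun q => gM q (lift Y' q) (lift Z' q)) =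
  push p v (fun y : N => gN y (Y' y) (Z' y)).
Proof.
move=> Wp tv sY sZ; rewrite pushforwardE; last exact: smooth_at_metric.
apply: (tangent_near tv).
have nY := near_pull spi (vsmooth_at_near sY).
have nZ := near_pull spi (vsmooth_at_near sZ).
apply: filterS3 (near_frame Wp) nY nZ => q Wq sYq sZq.
by apply: metric_lift => //; exact: vsmooth_at_tangent.
Qed.

Lemma metric_lie_lift p (Y' Z' V' : vfield N) : W p ->
  vsmooth_at (pi p) Y' -> vsmooth_at (pi p) Z' -> vsmooth_at (pi p) V' ->
  gM p (lie (lift Y') (lift Z') p) (lift V' p) =
  gN (pi p) (lie Y' Z' (pi p)) (V' (pi p)).
Proof.
move=> Wp sY sZ sV; have tV := vsmooth_at_tangent sV.
rewrite (metric_push_hproj Wp); last exact: horizontal_lift_field.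
  rewrite push_lift //; congr (gN _ _ _).
  by apply: (pushforward_lie spi) => //; do ?[exact: vsmooth_lift|exact: related_lift].
by apply: (tangent_lie hLC); exact: vsmooth_lift.
Qed.

(** Koszul's formula on both manifolds: the six terms agree one by one, because inner products of
    lifts are pulled back from the base and the bracket of two lifts pushes forward to the bracket
    downstairs. *)
Lemma metric_nabla_lift p (Y' Z' V' : vfield N) : W p ->
  vsmooth_at (pi p) Y' -> vsmooth_at (pi p) Z' -> vsmooth_at (pi p) V' ->
  gM p (nabla p (lift Y' p) (lift Z')) (lift V' p) =
  gN (pi p) (nablaN (pi p) (Y' (pi p)) Z') (V' (pi p)).
Proof.
move=> Wp sY sZ sV.
have two : (2 : R) != 0 by rewrite pnatr_eq0.
apply: (mulfI two).
rewrite (koszul hgM hLC) //; try exact: vsmooth_lift.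
rewrite (koszul hgN hLCN) // !metric_lie_lift //.
have pl (T' : vfield N) : vsmooth_at (pi p) T' -> push p (lift T' p) = T' (pi p).
  by move=> s; apply: push_lift => //; exact: vsmooth_at_tangent.
have tl (T' : vfield N) : vsmooth_at (pi p) T' -> tangent p (lift T' p).
  by move=> s; apply/vsmooth_at_tangent/vsmooth_lift.
rewrite (lift_metric_derive Wp (tl _ sY) sZ sV).
rewrite (lift_metric_derive Wp (tl _ sZ) sY sV).
by rewrite (lift_metric_derive Wp (tl _ sV) sY sZ) !pl.
Qed.

(** Both sides are horizontal, so it suffices to test against horizontal vectors, each of which is
    the value of some lift. *)
Lemma hproj_nabla_lift p (Y' Z' : vfield N) : W p ->
  vsmooth_at (pi p) Y' -> vsmooth_at (pi p) Z' ->
  hproj p (nabla p (lift Y' p) (lift Z')) =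
  lift (fun y : N => nablaN y (Y' y) Z') p.
Proof.
move=> Wp sY sZ.
have tL (V' : vfield N) : vsmooth_at (pi p) V' -> tangent p (lift V' p).
  by move=> s; apply: vsmooth_at_tangent; exact: vsmooth_lift.
have tn : tangent p (nabla p (lift Y' p) (lift Z')).
  by apply: nabla_tangent => //; [exact: tL | exact: vsmooth_lift].
apply: horizontal_eq; [exact: hproj_horizontal|exact: horizontal_lift_field|].
move=> z hz; rewrite -metric_hproj //.
have [sV Vz] := extendP (pushforward_tangent spi (horizontal_tangent hz)).
rewrite -(lift_val Wp hz Vz) metric_nabla_lift // metric_lift //.
  exact: (vsmooth_at_tangent (vsmooth_at_nabla hDN sY sZ)).
exact: vsmooth_at_tangent.
Qed.


(** * The tensor A on horizontal fields: tensoriality and alternation *)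

Lemma vertical_eq0 p u : W p -> vertical p u ->
  (forall k, gM p u (U k p) = 0) -> u = 0.
Proof.
move=> Wp vu u0; rewrite (vertical_expand Wp vu) big1 // => k _.
by rewrite u0 scale0r.
Qed.

Lemma vproj_sum p (I : Type) (s : seq I) (F : I -> tvec M) : W p ->
  (forall i, tangent p (F i)) ->
  vproj p (\sum_(i <- s) F i) = \sum_(i <- s) vproj p (F i).
Proof.
move=> Wp tF; elim: s => [|i s IH]; first by rewrite !big_nil vproj0.
by rewrite !big_cons vprojD // ?IH //; exact: tangent_sum.
Qed.

Lemma nabla_sub_lie p V Y : vsmooth_at p V -> vsmooth_at p Y ->
  nabla p (Y p) V = nabla p (V p) Y - lie V Y p.
Proof. by move=> sV sY; rewrite (nabla_torsion hLC) //; ring. Qed.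

(* For basic fields Y, Z and vertical V the brackets [V, Y], [V, Z] are       *)
(* vertical, so g(nabla_Y Z, V) + g(nabla_Z Y, V) = - V g(Y, Z), which        *)
(* vanishes because g(Y, Z) is constant along the fibres.                     *)
Lemma vproj_nabla_lift_anti p (Y' Z' : vfield N) : W p ->
  vsmooth_at (pi p) Y' -> vsmooth_at (pi p) Z' ->
  vproj p (nabla p (lift Y' p) (lift Z')) =
  - vproj p (nabla p (lift Z' p) (lift Y')).
Proof.
move=> Wp sY' sZ'.
have sY := vsmooth_lift Wp sY'; have sZ := vsmooth_lift Wp sZ'.
have tY := vsmooth_at_tangent sY; have tZ := vsmooth_at_tangent sZ.
have tYZ := nabla_tangent hD tY sZ; have tZY := nabla_tangent hD tZ sY.
have half (Z1 Z2 : vfield N) k : vsmooth_at (pi p) Z1 -> vsmooth_at (pi p) Z2 ->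
    gM p (vproj p (nabla p (lift Z1 p) (lift Z2))) (U k p) =
    - gM p (lift Z2 p) (nabla p (U k p) (lift Z1)).
  move=> s1 s2; have [sl1 sl2] := (vsmooth_lift Wp s1, vsmooth_lift Wp s2).
  have [t1 t2] := (vsmooth_at_tangent sl1, vsmooth_at_tangent sl2).
  have sU := vsmooth_U k Wp; have tU := vsmooth_at_tangent sU.
  rewrite -metric_vproj //; [|exact: nabla_tangent|exact: vertical_U].
  rewrite (nabla_hv_skew t1 sU sl2 (vertical_near_U k Wp) (horizontal_near_lift _ Wp)).
  have vl : vertical p (lie (U k) (lift Z1) p).
    exact: lie_vertical sU sl1 s1 (vertical_near_U k Wp) (related_lift Wp s1).
  rewrite (nabla_sub_lie sU sl1) (metricBr hgM) //;
    [|exact: nabla_tangent|exact: vertical_tangent].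
  by rewrite (metric_hv vl (horizontal_lift_field _ Wp)) subr0.
apply/eqP; rewrite -addr_eq0; apply/eqP; apply: (vertical_eq0 Wp) => [|k].
  by apply: verticalD; exact: vproj_vertical.
have tU := vsmooth_at_tangent (vsmooth_U k Wp).
rewrite (metricDl hgM) //; try by apply/vertical_tangent/vproj_vertical.
rewrite !half // -opprD (metricC hgM tZ (nabla_tangent hD tU sY)).
rewrite -(metric_compat hLC tU sY sZ) (lift_metric_derive Wp tU sY' sZ').
by have [_ ->] := vertical_U k Wp; rewrite oppr0.
Qed.

(** In the Leibniz rule for the frame expansion of [Y], the derivatives of the coefficients multiply
    the horizontal [X a], which [vproj] kills. Hence only the value of [Y] at [p] matters. *)
Lemma vproj_nabla_expand p x Y : W p -> tangent p x -> vsmooth_at p Y ->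
  horizontal_near p Y ->
  vproj p (nabla p x Y) =
  \sum_a gM p (Y p) (X a p) *: vproj p (nabla p x (X a)).
Proof.
move=> Wp tx sY nY.
have sX a := vsmooth_X a Wp; have tX a := vsmooth_at_tangent (sX a).
have sg a : smooth_at p (fun q => gM q (Y q) (X a q)) by exact: smooth_at_metric.
have tnX a : tangent p (nabla p x (X a)) by exact: nabla_tangent.
rewrite (nabla_near hD tx sY (Z := fun q => \sum_a gM q (Y q) (X a q) *: X a q)).
  rewrite (nabla_sum hD) //; last by move=> a; exact: vsmooth_at_scale.
  rewrite vproj_sum //; last first.
    by move=> a; apply: nabla_tangent => //; exact: vsmooth_at_scale.
  apply: eq_bigr => a _; rewrite (nabla_scale hD) //.
  rewrite vproj_lin //; last exact: tangentZ.
  rewrite (vproj_horizontal0 Wp (horizontal_X a Wp)) scaler0 add0r.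
  by rewrite vprojZ.
apply: filterS2 (near_frame Wp) nY => q Wq; exact: horizontal_expand.
Qed.

Lemma vproj_nabla_eq p x Y Z : W p -> tangent p x ->
  vsmooth_at p Y -> horizontal_near p Y ->
  vsmooth_at p Z -> horizontal_near p Z -> Y p = Z p ->
  vproj p (nabla p x Y) = vproj p (nabla p x Z).
Proof.
move=> Wp tx sY nY sZ nZ YZ.
by rewrite !vproj_nabla_expand //; apply: eq_bigr => a _; rewrite YZ.
Qed.

(** By tensoriality the fields may be replaced by lifts with the same values at [p], for which the
    alternation is already known. *)
Lemma vproj_nabla_anti p Y Z : W p -> vsmooth_at p Y -> vsmooth_at p Z ->
  horizontal_near p Y -> horizontal_near p Z ->
  vproj p (nabla p (Y p) Z) = - vproj p (nabla p (Z p) Y).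
Proof.
move=> Wp sY sZ nY nZ.
have [hY hZ] := (nbhs_singleton nY, nbhs_singleton nZ).
have [sY' eY] := extendP (pushforward_tangent spi (horizontal_tangent hY)).
have [sZ' eZ] := extendP (pushforward_tangent spi (horizontal_tangent hZ)).
have := vproj_nabla_lift_anti Wp sY' sZ'.
rewrite (lift_val Wp hY eY) (lift_val Wp hZ eZ) => anti.
rewrite (@vproj_nabla_eq p (Y p) Z (lift (extend (pi p) (push p (Z p))))) //;
  do ?[exact: vsmooth_lift|exact: horizontal_near_lift
      |by rewrite (lift_val Wp hZ eZ)|auto].
rewrite (@vproj_nabla_eq p (Z p) Y (lift (extend (pi p) (push p (Y p))))) //;
  do ?[exact: vsmooth_lift|exact: horizontal_near_lift
      |by rewrite (lift_val Wp hY eY)|auto].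
Qed.

Lemma vproj_nabla_self p Y : W p -> vsmooth_at p Y -> horizontal_near p Y ->
  vproj p (nabla p (Y p) Y) = 0.
Proof.
move=> Wp sY nY; have := vproj_nabla_anti Wp sY sY nY nY.
set v := vproj _ _ => /eqP; rewrite -addr_eq0 -mulr2n -scaler_nat scaler_eq0.
by rewrite pnatr_eq0 => /eqP.
Qed.

Lemma metric_nabla_self p Y u : W p -> vsmooth_at p Y -> horizontal_near p Y ->
  vertical p u -> gM p u (nabla p (Y p) Y) = 0.
Proof.
move=> Wp sY nY vu; have tn := nabla_tangent hD (vsmooth_at_tangent sY) sY.
rewrite (metricC hgM) //; last by auto.
by rewrite metric_vproj // vproj_nabla_self // (metric0l hgM); auto.
Qed.

(** The alternation of A, transferred to A_Y V by moving [V] to the other side of the metric. *)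
Lemma nabla_horizontal_swap p V Y Z : W p ->
  vsmooth_at p V -> vsmooth_at p Y -> vsmooth_at p Z ->
  vertical_near p V -> horizontal_near p Y -> horizontal_near p Z ->
  gM p (nabla p (Z p) V) (Y p) = - gM p (nabla p (Y p) V) (Z p).
Proof.
move=> Wp sV sY sZ nV nY nZ.
have [tV tY tZ] := And3 (vsmooth_at_tangent sV) (vsmooth_at_tangent sY)
                        (vsmooth_at_tangent sZ).
have vV := nbhs_singleton nV.
have tZY := nabla_tangent hD tZ sY; have tYZ := nabla_tangent hD tY sZ.
rewrite !nabla_vh_skew // (metricC hgM tV tZY) (metricC hgM tV tYZ).
rewrite (metric_vproj Wp tZY vV) (metric_vproj Wp tYZ vV).
rewrite (vproj_nabla_anti Wp sZ sY) //.
by rewrite (metricNl hgM) //; apply/vertical_tangent/vproj_vertical.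
Qed.

(** * Curvature *)

(** The Gauss equation of the fibres. The inner derivatives are split into vertical parts, which
    build the fibre curvature, and horizontal parts, whose derivative is moved onto [V] and leaves
    products of second fundamental forms. *)
Lemma vertical_curvature p V Z : W p -> vsmooth_at p V -> vsmooth_at p Z ->
  vertical_near p V -> vertical_near p Z ->
  gM p (curv nabla V Z Z p) (V p) =
  gM p (fiber_curv gM nabla pi V Z Z p) (V p)
  + gM p (hproj p (nabla p (Z p) Z)) (hproj p (nabla p (V p) V))
  - gM p (hproj p (nabla p (V p) Z)) (hproj p (nabla p (Z p) V)).
Proof.
move=> Wp sV sZ nV nZ.
have [tV tZ] := (vsmooth_at_tangent sV, vsmooth_at_tangent sZ).
have vV := nbhs_singleton nV.
have tl := tangent_lie hLC sV sZ.
have sVZ := vsmooth_at_nabla hD sV sZ; have sZZ := vsmooth_at_nabla hD sZ sZ.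
have [svVZ shVZ] := (vsmooth_vpart Wp sVZ, vsmooth_hpart Wp sVZ).
have [svZZ shZZ] := (vsmooth_vpart Wp sZZ, vsmooth_hpart Wp sZZ).
have tn v Y : tangent p v -> vsmooth_at p Y -> tangent p (nabla p v Y).
  exact: nabla_tangent.
have tvn v Y : tangent p v -> vsmooth_at p Y ->
    tangent p (vproj p (nabla p v Y)).
  by move=> *; apply/vertical_tangent/vproj_vertical => //; exact: tn.
have split v Y : tangent p v -> vsmooth_at p Y ->
    gM p (nabla p v Y) (V p) = gM p (vproj p (nabla p v (vpart Y))) (V p)
     - gM p (hpart Y p) (hproj p (nabla p v V)).
  move=> tv sY; have [svY shY] := (vsmooth_vpart Wp sY, vsmooth_hpart Wp sY).
  have hY := horizontal_near_hpart Wp sY.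
  rewrite (nabla_vpart_hpart Wp tv sY) (metricDl hgM) //; try exact: tn.
  rewrite -(metric_vproj Wp) //; last exact: tn.
  rewrite (nabla_hv_skew tv sV shY nV hY); congr (_ - _).
  have hYp := nbhs_singleton hY.
  rewrite (metricC hgM) //; try by [exact: tn|auto].
  rewrite (metric_hproj Wp) //; last exact: tn.
  by rewrite (metricC hgM) //; apply: horizontal_tangent => //;
    apply: hproj_horizontal => //; exact: tn.
rewrite /curv /fiber_curv /curv (metric_subDl hgM); try exact: tn; last by [].
rewrite [X in _ = X + _ - _](metric_subDl hgM); try exact: tvn; last by [].
rewrite (split _ _ tV sZZ) (split _ _ tZ sVZ).
rewrite (metric_vproj Wp (tn _ _ tl sZ) vV).
by rewrite /Defs.hpart /Defs.vpart; ring.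
Qed.

(** The last two terms together are -g((nabla_Y T)(V,V), Y): the derivative of T_V V is corrected
    once for each argument, and symmetry of T gives the factor 2. The term of O'Neill's equation
    with the derivative of A drops out because A is alternating. *)
Lemma mixed_curvature p V Y : W p -> vsmooth_at p V -> vsmooth_at p Y ->
  vertical_near p V -> horizontal_near p Y ->
  gM p (curv nabla Y V V p) (Y p) =
  gM p (vproj p (nabla p (V p) Y)) (vproj p (nabla p (V p) Y))
  - gM p (hproj p (nabla p (Y p) V)) (hproj p (nabla p (Y p) V))
  - gM p (nabla p (Y p) (hpart (fun q => nabla q (V q) V))) (Y p)
  + 2 * gM p (nabla p (V p) (vpart (fun q => nabla q (Y q) V))) (Y p).
Proof.
move=> Wp sV sY nV nY.
have [tV tY] := (vsmooth_at_tangent sV, vsmooth_at_tangent sY).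
have [vV hY] := (nbhs_singleton nV, nbhs_singleton nY).
set P : vfield M := fun q => nabla q (V q) V.
set Q : vfield M := fun q => nabla q (Y q) V.
pose T : vfield M := fun q => nabla q (V q) Y.
have sP : vsmooth_at p P := vsmooth_at_nabla hD sV sV.
have sQ : vsmooth_at p Q := vsmooth_at_nabla hD sY sV.
have sT : vsmooth_at p T := vsmooth_at_nabla hD sV sY.
have tn v Z : tangent p v -> vsmooth_at p Z -> tangent p (nabla p v Z).
  exact: nabla_tangent.
have [tQ tT] := (vsmooth_at_tangent sQ, vsmooth_at_tangent sT).
have sv Z : vsmooth_at p Z -> vsmooth_at p (vpart Z) by exact: vsmooth_vpart.
have sh Z : vsmooth_at p Z -> vsmooth_at p (hpart Z) by exact: vsmooth_hpart.
have nv Z : vsmooth_at p Z -> vertical_near p (vpart Z).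
  exact: vertical_near_vpart.
have nh Z : vsmooth_at p Z -> horizontal_near p (hpart Z).
  exact: horizontal_near_hpart.
have tv Z : vsmooth_at p Z -> tangent p (vpart Z p).
  by move=> s; exact/vsmooth_at_tangent/sv.
have th Z : vsmooth_at p Z -> tangent p (hpart Z p).
  by move=> s; exact/vsmooth_at_tangent/sh.
(* The vertical part of [P] contributes -g(vP, nabla_Y Y), which vanishes since A_Y Y = 0. *)
have E1 : gM p (nabla p (Y p) P) (Y p) = gM p (nabla p (Y p) (hpart P)) (Y p).
  rewrite (nabla_vpart_hpart Wp tY sP) (metricDl hgM) //; try by apply: tn; auto.
  rewrite (nabla_vh_skew tY (sv _ sP) sY (nv _ sP) nY).
  by rewrite metric_nabla_self // ?oppr0 ?add0r //; exact: nbhs_singleton (nv _ sP).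
(* The horizontal part of [Q] is A_Y V, orthogonal to [Y] near [p] because A_Y Y = 0; its derivative
   along [V] can therefore be moved onto [Y]. *)
have hQY : \forall q \near p, gM q (hpart Q q) (Y q) = 0.
  apply: filterS3 (near_frame Wp) (filterI (vsmooth_at_near sV) (vsmooth_at_near sY))
    (filterI (near_join nV) (near_join nY)) => q Wq [sVq sYq] [nVq nYq].
  have [tVq tYq] := (vsmooth_at_tangent sVq, vsmooth_at_tangent sYq).
  rewrite -(metric_hproj Wq); [|exact: nabla_tangent|exact: nbhs_singleton nYq].
  rewrite /Q (nabla_vh_skew tYq sVq sYq nVq nYq) metric_nabla_self // ?oppr0 //.
  exact: nbhs_singleton nVq.
have E2 : gM p (nabla p (V p) Q) (Y p) =
    gM p (nabla p (V p) (vpart Q)) (Y p) - gM p (hpart Q p) (hpart T p).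
  rewrite (nabla_vpart_hpart Wp tV sQ) (metricDl hgM) //; try by apply: tn; auto.
  rewrite (metric_compat_const hLC tV (sh _ sQ) sY hQY); congr (_ - _).
  rewrite !(metricC hgM (th _ sQ)) //; auto.
  by rewrite (metric_hproj Wp) //; exact: nbhs_singleton (nh _ sQ).
(* Used for [Q] and [T], whose difference is [Y, V]. The vertical part of [Z] is exchanged with [V]
   by symmetry of T, the horizontal part with [Y] by alternation of A. *)
have E3 Z : vsmooth_at p Z -> gM p (nabla p (Z p) V) (Y p) =
    gM p (nabla p (V p) (vpart Z)) (Y p) - gM p (hpart Q p) (hpart Z p).
  move=> sZ; rewrite -{1}[Z p](vproj_hproj p).
  rewrite (nablaDl hD (tv _ sZ) (th _ sZ) sV).
  rewrite (metricDl hgM) //; try by apply: tn; auto.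
  rewrite (nabla_vertical_sym (sv _ sZ) sV (nv _ sZ) nV hY).
  rewrite (nabla_horizontal_swap Wp sV sY (sh _ sZ) nV nY (nh _ sZ)).
  congr (_ - _).
  by rewrite (metric_hproj Wp) //; exact: nbhs_singleton (nh _ sZ).
have E4 : gM p (nabla p (V p) (vpart T)) (Y p) = - gM p (vpart T p) (vpart T p).
  rewrite (nabla_vh_skew tV (sv _ sT) sY (nv _ sT) nY); congr (- _).
  rewrite (metricC hgM (tv _ sT)) //.
  by rewrite (metric_vproj Wp) //; exact: nbhs_singleton (nv _ sT).
have tl := tangent_lie hLC sY sV.
rewrite /curv (metric_subDl hgM) //; try exact: tn.
rewrite (nabla_torsion hLC) // -[nabla p (Y p) V]/(Q p) -[nabla p (V p) Y]/(T p).
rewrite (nablaBl hD) // (metricBl hgM) //; try exact: tn.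
rewrite -/P -/Q E1 E2 !E3 // E4 /Defs.hpart /Defs.vpart.
by ring.
Qed.

(** The base curvature has a horizontal lift, so the choice in [base_curv] is a genuine solution and
    not the default 0. *)
Lemma base_curvP p x y z : W p -> tangent p x -> tangent p y -> tangent p z ->
  horizontal p (base_curv gM nablaN pi p x y z) /\
  push p (base_curv gM nablaN pi p x y z) =
  curv_at nablaN (pi p) (push p x) (push p y) (push p z).
Proof.
move=> Wp tx ty tz.
have [sx _] := extendP (pushforward_tangent spi tx).
have [sy _] := extendP (pushforward_tangent spi ty).
have [sz _] := extendP (pushforward_tangent spi tz).
have tc : tangent (pi p)
    (curv_at nablaN (pi p) (push p x) (push p y) (push p z)).
  rewrite /curv_at /curv; apply: tangentD; first apply: tangentB.
  - by apply: nabla_tangent => //; exact: (tangent_lie hLCN).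
  - apply: nabla_tangent => //; first exact: vsmooth_at_tangent.
    exact: vsmooth_at_nabla.
  - apply: nabla_tangent => //; first exact: vsmooth_at_tangent.
    exact: vsmooth_at_nabla.
have [h hh hE] := horizontal_lift Wp tc.
have := @xgetPex _ 0 [set w | horizontal p w /\ push p w =
   curv_at nablaN (pi p) (push p x) (push p y) (push p z)].
by apply; exists h.
Qed.

(** One pair of fields through [x] and [y] suffices, as the space form curvature depends only on
    values at [p]. Of the factor 3, two units come from the vertical part of [Y, Z] and one from
    differentiating the vertical part of nabla_Y Z. *)
Lemma horizontal_curvature p x y : W p -> horizontal p x -> horizontal p y ->
  exists Y Z : vfield M, [/\ vsmooth_at p Y, vsmooth_at p Z,
    horizontal_near p Y, horizontal_near p Z & [/\ Y p = x, Z p = y &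
    gM p (curv nabla Y Z Z p) (Y p) =
    gM p (base_curv gM nablaN pi p x y y) x
    + 3 * gM p (vproj p (nabla p x Z)) (vproj p (nabla p x Z))]].
Proof.
move=> Wp hx hy.
(* [curv_at] is computed with exactly these extensions, so the base terms will match literally. *)
have [sY' eY] := extendP (pushforward_tangent spi (horizontal_tangent hx)).
have [sZ' eZ] := extendP (pushforward_tangent spi (horizontal_tangent hy)).
set Y' := extend _ _ in sY' eY; set Z' := extend _ _ in sZ' eZ.
pose Y := lift Y'; pose Z := lift Z'.
have Yx : Y p = x by exact: lift_val.
have Zy : Z p = y by exact: lift_val.
have sY : vsmooth_at p Y by exact: vsmooth_lift.
have sZ : vsmooth_at p Z by exact: vsmooth_lift.
have [nY nZ] : horizontal_near p Y /\ horizontal_near p Z.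
  by split; exact: horizontal_near_lift.
exists Y, Z; split=> //; split=> //.
have [tY tZ] := (vsmooth_at_tangent sY, vsmooth_at_tangent sZ).
have tn v V : tangent p v -> vsmooth_at p V -> tangent p (nabla p v V).
  exact: nabla_tangent.
pose P' : vfield N := fun q : N => nablaN q (Z' q) Z'.
pose Q' : vfield N := fun q : N => nablaN q (Y' q) Z'.
have sP' : vsmooth_at (pi p) P' := vsmooth_at_nabla hDN sZ' sZ'.
have sQ' : vsmooth_at (pi p) Q' := vsmooth_at_nabla hDN sY' sZ'.
have sL' : vsmooth_at (pi p) (lie Y' Z') := vsmooth_at_lie hLCN sY' sZ'.
pose Q : vfield M := fun q => nabla q (Y q) Z.
have sQ : vsmooth_at p Q := vsmooth_at_nabla hD sY sZ.
have sw := vsmooth_vpart Wp sQ; have nw := vertical_near_vpart Wp sQ.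
have vw := nbhs_singleton nw; have tw := vsmooth_at_tangent sw.
have nY' := near_pull spi (vsmooth_at_near sY').
have nZ' := near_pull spi (vsmooth_at_near sZ').
(* Since A_Z Z = 0 near [p], nabla_Z Z is horizontal there and coincides with the lift of [P']. *)
have PE : nabla p (Y p) (fun q => nabla q (Z q) Z) = nabla p (Y p) (lift P').
  apply: (nabla_near hD) => //; first exact: vsmooth_at_nabla.
  apply: filterS3 (near_frame Wp) nZ'
    (filterI (vsmooth_at_near sZ) (near_join nZ)) => q Wq sq [sZq nZq].
  rewrite -[LHS](vproj_hproj q) vproj_nabla_self // add0r.
  exact: hproj_nabla_lift.
have QE : nabla p (Z p) Q = nabla p (Z p) (lift Q') + nabla p (Z p) (vpart Q).
  rewrite (nabla_vpart_hpart Wp tZ sQ) addrC; congr (_ + _).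
  apply: (nabla_near hD) => //; first exact: vsmooth_hpart.
  by apply: filterS3 (near_frame Wp) nY' nZ' => q Wq ? ?; exact: hproj_nabla_lift.
have tl := tangent_lie hLC sY sZ.
(* The vertical part of [Y, Z] is A_Y Z - A_Z Y = 2 A_Y Z. *)
have LE : lie Y Z p = lift (lie Y' Z') p + 2 *: vpart Q p.
  rewrite -[LHS](vproj_hproj p) addrC; congr (_ + _).
    apply: push_inj; [exact: hproj_horizontal|exact: horizontal_lift_field|].
    rewrite push_hproj // push_lift //; last exact: vsmooth_at_tangent.
    by apply: (pushforward_lie spi) => //; exact: related_lift.
  rewrite (nabla_torsion hLC) // vprojB //; try exact: tn.
  by rewrite (vproj_nabla_anti Wp sZ sY) // opprK scaler_nat mulr2n.
have wE : gM p (nabla p (Z p) (vpart Q)) (Y p) = gM p (vpart Q p) (vpart Q p).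
  rewrite (nabla_vh_skew tZ sw sY nw nY) (metricC hgM tw (tn _ _ tZ sY)).
  rewrite (metric_vproj Wp) //; last exact: tn.
  rewrite (vproj_nabla_anti Wp sZ sY) // (metricNl hgM) ?opprK //.
(* [Z] is a lift, so its bracket with the vertical field is vertical and the two fields may be
   exchanged in the derivative. *)
have wZ : gM p (nabla p (vpart Q p) Z) (Y p) = gM p (vpart Q p) (vpart Q p).
  rewrite -wE [in RHS](nabla_sub_lie sw sZ) (metricBl hgM) //; try exact: tn.
    rewrite [X in _ - X](metric_vh (x := Y p)) ?subr0 //; first last.
    - exact: nbhs_singleton nY.
    - exact: lie_vertical sw sZ sZ' nw (related_lift Wp sZ').
  exact: (tangent_lie hLC).
have tLl : tangent p (lift (lie Y' Z') p).
  by apply: vsmooth_at_tangent; exact: vsmooth_lift.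
have sLP : vsmooth_at p (lift P') by exact: vsmooth_lift.
have sLQ : vsmooth_at p (lift Q') by exact: vsmooth_lift.
have t2w : tangent p (2 *: vpart Q p) by exact: tangentZ.
rewrite /curv -/Q PE QE LE (nablaDl hD) // (nablaZl hD) //.
rewrite (metricDl hgM) ?(metricBl hgM) ?(metricDl hgM) ?(metricZl hgM) //;
  do ?[exact: tn|apply: tangentB|apply: tangentD|apply: tangentZ].
rewrite wE wZ !metric_nabla_lift //.
have [hb bE] := base_curvP Wp (horizontal_tangent hx) (horizontal_tangent hy)
  (horizontal_tangent hy).
have tN (v : tvec N) (V : vfield N) : tangent (pi p) v -> vsmooth_at (pi p) V ->
    tangent (pi p) (nablaN (pi p) v V) by exact: nabla_tangent.
have [tY' tZ'] := (vsmooth_at_tangent sY', vsmooth_at_tangent sZ').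
have tl' := tangent_lie hLCN sY' sZ'.
rewrite -(metric_push hb hx) bE -eY -eZ /curv_at eY eZ -/Y' -/Z' /curv.
rewrite -eY -/P' -/Q' (metric_subDl hgN) //; try exact: tN.
rewrite eZ -Yx -[vproj p (nabla p (Y p) Z)]/(vpart Q p).
by ring.
Qed.

(** * The O'Neill tensors on the frame *)

(** Near [p] the projections of a vertical field are itself and 0, which reduces each O'Neill tensor
    to one projected derivative. *)
Lemma oneill_vertical p V Z v : W p -> tangent p v -> vsmooth_at p Z ->
  vertical_near p Z ->
  nabla p v (vpart Z) = nabla p v Z /\ nabla p v (hpart Z) = 0.
Proof.
move=> Wp tv sZ nZ; split.
  apply: (nabla_near hD) => //; first exact: vsmooth_vpart.
  by apply: filterS2 (near_frame Wp) nZ => q Wq; exact: vproj_id.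
rewrite -[RHS](nabla0 hD tv); apply: (nabla_near hD) => //.
  exact: vsmooth_hpart.
by apply: filterS2 (near_frame Wp) nZ => q Wq; exact: hproj_vertical0.
Qed.

Lemma oneill_horizontal p Y v : W p -> tangent p v -> vsmooth_at p Y ->
  horizontal_near p Y ->
  nabla p v (hpart Y) = nabla p v Y /\ nabla p v (vpart Y) = 0.
Proof.
move=> Wp tv sZ nZ; split.
  apply: (nabla_near hD) => //; first exact: vsmooth_hpart.
  by apply: filterS2 (near_frame Wp) nZ => q Wq; exact: hproj_id.
rewrite -[RHS](nabla0 hD tv); apply: (nabla_near hD) => //.
  exact: vsmooth_vpart.
by apply: filterS2 (near_frame Wp) nZ => q Wq; exact: vproj_horizontal0.
Qed.

Lemma oneillT_vertical p V Z : W p -> vertical p (V p) -> vsmooth_at p Z ->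
  vertical_near p Z ->
  oneillT gM nabla pi V Z p = hproj p (nabla p (V p) Z).
Proof.
move=> Wp vV sZ nZ; rewrite /oneillT /Defs.vpart vproj_id // -/(vpart Z).
have [-> ->] := oneill_vertical V Wp (vertical_tangent vV) sZ nZ.
by rewrite vproj0 // addr0.
Qed.

Lemma oneillT_horizontal p V Y : W p -> vertical p (V p) -> vsmooth_at p Y ->
  horizontal_near p Y ->
  oneillT gM nabla pi V Y p = vproj p (nabla p (V p) Y).
Proof.
move=> Wp vV sY nY; rewrite /oneillT /Defs.vpart vproj_id // -/(vpart Y).
have [-> ->] := oneill_horizontal Wp (vertical_tangent vV) sY nY.
by rewrite hproj0 // add0r.
Qed.

Lemma oneillA_vertical p Y Z : W p -> horizontal p (Y p) -> vsmooth_at p Z ->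
  vertical_near p Z ->
  oneillA gM nabla pi Y Z p = hproj p (nabla p (Y p) Z).
Proof.
move=> Wp hY sZ nZ; have hYE : hpart Y p = Y p by exact: hproj_id.
rewrite /oneillA hYE.
have [-> ->] := oneill_vertical Y Wp (horizontal_tangent hY) sZ nZ.
by rewrite vproj0 // addr0.
Qed.

Lemma oneillA_horizontal p Y Z : W p -> horizontal p (Y p) -> vsmooth_at p Z ->
  horizontal_near p Z ->
  oneillA gM nabla pi Y Z p = vproj p (nabla p (Y p) Z).
Proof.
move=> Wp hY sZ nZ; have hYE : hpart Y p = Y p by exact: hproj_id.
rewrite /oneillA hYE.
have [-> ->] := oneill_horizontal Wp (horizontal_tangent hY) sZ nZ.
by rewrite hproj0 // add0r.
Qed.

Local Notation T i j p := (oneillT gM nabla pi (U i) (U j) p).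
Local Notation H := (mean_curv gM nabla pi U).

Lemma oneillT_frame p i j : W p -> T i j p = hproj p (nabla p (U i p) (U j)).
Proof.
move=> Wp; apply: oneillT_vertical => //; first exact: vertical_U.
  exact: vsmooth_U.
exact: vertical_near_U.
Qed.

Lemma tangent_nabla_U p v i : W p -> tangent p v -> tangent p (nabla p v (U i)).
Proof. by move=> Wp tv; apply: nabla_tangent => //; exact: vsmooth_U. Qed.

Lemma tangent_U p i : W p -> tangent p (U i p).
Proof. by move=> Wp; apply/vertical_tangent/vertical_U. Qed.

Lemma tangent_X p i : W p -> tangent p (X i p).
Proof. by move=> Wp; apply/horizontal_tangent/horizontal_X. Qed.

Lemma horizontal_T p i j : W p -> horizontal p (T i j p).
Proof.
move=> Wp; rewrite oneillT_frame //; apply: hproj_horizontal => //.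
by apply: tangent_nabla_U => //; exact: tangent_U.
Qed.

Lemma horizontal_mean_curv p : W p -> horizontal p (H p).
Proof.
by move=> Wp; apply: horizontalZ; apply: horizontal_sum => j; exact: horizontal_T.
Qed.

Lemma oneillT_sym p i j : W p -> T i j p = T j i p.
Proof.
move=> Wp; apply: horizontal_eq; [exact: horizontal_T|exact: horizontal_T|].
move=> z hz; have [tUi tUj] := (tangent_U i Wp, tangent_U j Wp).
have [sz ez] := extendP (horizontal_tangent hz).
rewrite !oneillT_frame // -!metric_hproj //; try exact: tangent_nabla_U.
rewrite -ez; apply: nabla_vertical_sym; do ?[exact: vsmooth_U|exact: vertical_near_U].
by rewrite ez.
Qed.

(** Tensoriality of T: after moving the derivative onto [X i], only the values of [V] and [Z] at [p]
    enter, and these are expanded in the frame. *)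
Lemma metric_nabla_vertical p V Z i : W p -> vertical p (V p) -> vsmooth_at p Z ->
  vertical_near p Z ->
  gM p (nabla p (V p) Z) (X i p) =
  \sum_k \sum_h gM p (V p) (U k p) * gM p (Z p) (U h p) * gM p (T k h p) (X i p).
Proof.
move=> Wp vV sZ nZ; have sX := vsmooth_X i Wp; have nX := horizontal_near_X i Wp.
have [hX vZ] := (nbhs_singleton nX, nbhs_singleton nZ).
have tU k := tangent_U k Wp; have tV := vertical_tangent vV.
have tX := horizontal_tangent hX.
have tUX k : tangent p (nabla p (U k p) (X i)) by exact: nabla_tangent.
have tVX : tangent p (nabla p (V p) (X i)) by exact: nabla_tangent.
rewrite (nabla_vh_skew tV sZ sX nZ nX) {1}(vertical_expand Wp vV).
rewrite (nabla_suml hD) //; last by move=> k; exact: tangentZ.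
rewrite (metric_sumr hgM) //; last first.
- exact: vertical_tangent.
- by move=> k; apply: nabla_tangent => //; exact: tangentZ.
rewrite -sumrN; apply: eq_bigr => k _.
rewrite (nablaZl hD) // (metricZr hgM) //; last exact: vertical_tangent.
rewrite {1}(vertical_expand Wp vZ) (metric_suml hgM) //; last first.
  by move=> h; exact: tangentZ.
rewrite mulr_sumr -sumrN; apply: eq_bigr => h _; rewrite (metricZl hgM) //.
rewrite oneillT_frame // -metric_hproj //; last exact: tangent_nabla_U.
rewrite (nabla_vh_skew (tU k) (vsmooth_U h Wp) sX (vertical_near_U h Wp) nX).
by rewrite mulrN mulrA.
Qed.

(* The connection coefficients g(nabla_X U_k, U_h) are skew in k, h, while    *)
(* T is symmetric.                                                            *)
Lemma sum_metric_nabla_connection p i : W p ->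
  \sum_k gM p (nabla p (U k p) (vpart (fun q => nabla q (X i q) (U k)))) (X i p)
  = 0.
Proof.
move=> Wp; have sX := vsmooth_X i Wp; have nX := horizontal_near_X i Wp.
have [tU tX] := (fun k => tangent_U k Wp, tangent_X i Wp).
have sU k := vsmooth_U k Wp; have nU k := vertical_near_U k Wp.
pose C k h := gM p (nabla p (X i p) (U k)) (U h p).
have CN k h : C k h = - C h k.
  rewrite /C (metric_compat_const hLC tX (sU k) (sU h) (a := (k == h)%:R)).
    by rewrite (metricC hgM) //; exact: tangent_nabla_U.
  apply: filterS (near_frame Wp) => q Wq.
  by case: hF => _ _ _ /(_ q Wq) [e _] _; exact: e.
pose S k h := gM p (T k h p) (X i p).
have -> : \sum_k gM p (nabla p (U k p)
    (vpart (fun q => nabla q (X i q) (U k)))) (X i p) = \sum_k \sum_h C k h * S k h.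
  apply: eq_bigr => k _.
  have sXU := vsmooth_at_nabla hD sX (sU k).
  rewrite (nabla_vh_skew (tU k) (vsmooth_vpart Wp sXU) sX
    (vertical_near_vpart Wp sXU) nX).
  have tUX : tangent p (nabla p (U k p) (X i)) by exact: nabla_tangent.
  have tXU : tangent p (nabla p (X i p) (U k)) by exact: tangent_nabla_U.
  rewrite /Defs.vpart vprojE // (metric_suml hgM) //; last first.
    by move=> h; exact: tangentZ.
  rewrite -sumrN; apply: eq_bigr => h _.
  rewrite (metricZl hgM) // /S oneillT_frame // -metric_hproj //; first last.
  - exact: horizontal_X.
  - exact: tangent_nabla_U.
  by rewrite (nabla_vh_skew (tU k) (sU h) sX (nU h) nX) mulrN.
set s := \sum_k _; suff : s = - s.
  by move=> /eqP; rewrite -addr_eq0 -mulr2n -mulr_natl mulf_eq0 pnatr_eq0 => /eqP.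
rewrite {1}/s exchange_big -sumrN; apply: eq_bigr => k _.
rewrite -sumrN; apply: eq_bigr => h _ /=.
by rewrite CN /S (oneillT_sym h k Wp) mulNr.
Qed.

(** * Curvature sums *)

(** The products g(T_ii, T_jj) add up to |N|^2, and symmetry of T turns g(T_ij, T_ji) into
    |T_ij|^2. *)
Lemma vertical_curvature_sum p : W p ->
  \sum_i \sum_j gM p (curv nabla (U j) (U i) (U i) p) (U j p) =
  tau_fiber gM nabla pi U p
  + gM p (normal_field gM nabla pi U p) (normal_field gM nabla pi U p)
  - \sum_i \sum_j gM p (T i j p) (T i j p).
Proof.
move=> Wp; have tT i j : tangent p (T i j p).
  exact/horizontal_tangent/horizontal_T.
have -> : gM p (normal_field gM nabla pi U p) (normal_field gM nabla pi U p) =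
    \sum_i \sum_j gM p (T i i p) (T j j p).
  rewrite (metric_suml hgM) //; last exact: tangent_sum.
  by apply: eq_bigr => i _; rewrite (metric_sumr hgM).
rewrite /tau_fiber -big_split -sumrB; apply: eq_bigr => i _ /=.
rewrite -big_split -sumrB; apply: eq_bigr => j _ /=.
rewrite vertical_curvature //; do ?[exact: vsmooth_U|exact: vertical_near_U].
by rewrite -!oneillT_frame // (oneillT_sym j i).
Qed.

Lemma mixed_curvature_sum p : W p ->
  \sum_i \sum_k gM p (curv nabla (X i) (U k) (U k) p) (X i p) =
  sqTV gM nabla pi U X p - sqAH gM nabla pi U X p - deltaN gM nabla pi U X p.
Proof.
move=> Wp; rewrite /sqTV /sqAH /deltaN -!sumrB; apply: eq_bigr => i _.
have sX := vsmooth_X i Wp; have nX := horizontal_near_X i Wp.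
have [tU tX] := (fun k => tangent_U k Wp, tangent_X i Wp).
have sU k := vsmooth_U k Wp; have nU k := vertical_near_U k Wp.
pose S k : vfield M := hpart (fun q => nabla q (U k q) (U k)).
have sS k : vsmooth_at p (S k).
  by apply: vsmooth_hpart => //; exact: vsmooth_at_nabla.
have -> : nabla p (X i p) (normal_field gM nabla pi U) =
    \sum_k nabla p (X i p) (S k).
  rewrite -(nabla_sum hD) //; apply/esym; apply: (nabla_near hD) => //.
    exact: vsmooth_at_sum.
  apply: filterS (near_frame Wp) => q Wq; apply: eq_bigr => k _.
  by rewrite oneillT_frame.
rewrite (metric_suml hgM) //; last by move=> k; exact: nabla_tangent.
(* Twice the vanishing connection sum is inserted on the right to match the last term of
   [mixed_curvature] for each [k]. *)
rewrite -!sumrB -[RHS]addr0 -[X in _ = _ + X](mulr0 2).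
rewrite -[X in _ = _ + 2 * X](sum_metric_nabla_connection i Wp) mulr_sumr.
rewrite -big_split /=.
apply: eq_bigr => k _; rewrite mixed_curvature //.
rewrite oneillT_horizontal //; last exact: vertical_U.
by rewrite oneillA_vertical //; exact: horizontal_X.
Qed.

(** * The space form curvature, the defect identity and the equality case *)

Section SpaceForm.
Variables (c : R) (J : 'Z_3 -> M -> tvec M -> tvec M).
Variable E : M -> set (tvec M -> tvec M).
Hypothesis hJ : quaternionic_basis gM E W J.
Hypothesis hanti : forall a p u, W p -> vertical p u -> horizontal p (J a p u).
Hypothesis hcurv : forall p Y Z V, W p ->
  vsmooth_at p Y -> vsmooth_at p Z -> vsmooth_at p V ->
    curv nabla Y Z V p = (c / 4) *:
      (gM p (Z p) (V p) *: Y p - gM p (Y p) (V p) *: Z p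
       + \sum_(a : 'Z_3)
           (gM p (J a p (Z p)) (V p) *: J a p (Y p)
            - gM p (J a p (Y p)) (V p) *: J a p (Z p)
            + (2 * gM p (J a p (Z p)) (Y p)) *: J a p (V p))).

Lemma J_tangent a p v : W p -> tangent p v -> tangent p (J a p v).
Proof. by case: hJ => -[h _ _] _ _ _ _; exact: h. Qed.

(** Each J_a is an isometry with square -1, so g(Ju, v) = g(JJu, Jv) = -g(u, Jv). *)
Lemma J_skew a p u v : W p -> tangent p u -> tangent p v ->
  gM p (J a p u) v = - gM p u (J a p v).
Proof.
move=> Wp tu tv; case: hJ => _ _ J2 _ Jg; have tJ := J_tangent a Wp.
by rewrite -(Jg a p _ _ Wp (tJ _ tu) tv) J2 // (metricNl hgM) //; exact: tJ.
Qed.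

(** By skewness g(J_a Z, Z) = 0, and the two surviving J-terms, with weights 1 and 2, combine into
    the factor 3. *)
Lemma space_form_curvature p Y Z : W p -> vsmooth_at p Y -> vsmooth_at p Z ->
  gM p (curv nabla Y Z Z p) (Y p) =
  c / 4 * (gM p (Y p) (Y p) * gM p (Z p) (Z p) - gM p (Y p) (Z p) ^+ 2
           + 3 * \sum_a gM p (J a p (Y p)) (Z p) ^+ 2).
Proof.
move=> Wp sY sZ; have [tY tZ] := (vsmooth_at_tangent sY, vsmooth_at_tangent sZ).
have tJ a v : tangent p v -> tangent p (J a p v) by exact: J_tangent.
have tZs (s : R) v : tangent p v -> tangent p (s *: v) by exact: tangentZ.
have tS a : tangent p
   (gM p (J a p (Z p)) (Z p) *: J a p (Y p)
    - gM p (J a p (Y p)) (Z p) *: J a p (Z p)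
    + (2 * gM p (J a p (Z p)) (Y p)) *: J a p (Z p)).
  by apply: tangentD; [apply: tangentB|]; apply: tZs; exact: tJ.
have J0 a : gM p (J a p (Z p)) (Z p) = 0.
  have /eqP := J_skew a Wp tZ tZ; rewrite (metricC hgM tZ (tJ a _ tZ)).
  by rewrite -addr_eq0 -mulr2n -mulr_natl mulf_eq0 pnatr_eq0 => /eqP.
have tsum := tangent_sum (index_enum 'Z_3) tS.
have t1 := tZs (gM p (Z p) (Z p)) _ tY.
have t2 := tZs (gM p (Y p) (Z p)) _ tZ.
rewrite hcurv // (metricZl hgM) //; last by apply: tangentD => //; exact: tangentB.
congr (_ * _); rewrite (metric_subDl hgM) // !(metricZl hgM) //.
rewrite (metric_suml hgM) // (metricC hgM tZ tY) -expr2 [X in X - _]mulrC.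
congr (_ + _); rewrite mulr_sumr; apply: eq_bigr => a _.
rewrite (metric_subDl hgM) //; try by apply: tZs; exact: tJ.
rewrite !(metricZl hgM) //; try exact: tJ.
rewrite J0 mul0r (J_skew a Wp tZ tY) (metricC hgM tZ (tJ a _ tY)).
by ring.
Qed.

Lemma sqB_sqC_frame p i : W p -> forall a,
  sqB gM pi U X (J a) i p = \sum_k gM p (J a p (X i p)) (U k p) ^+ 2 /\
  sqC gM pi X (J a) i p = \sum_j gM p (J a p (X i p)) (X j p) ^+ 2.
Proof.
move=> Wp a; have tJ := J_tangent a Wp (tangent_X i Wp).
split; apply: eq_bigr => k _.
  by rewrite -metric_vproj //; exact: vertical_U.
by rewrite -metric_hproj //; exact: horizontal_X.
Qed.

Lemma frame_UU p k h : W p -> gM p (U k p) (U h p) = (k == h)%:R.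
Proof. by move=> Wp; case: hF => _ _ _ /(_ p Wp) [e _] _; exact: e. Qed.

Lemma frame_XX p i j : W p -> gM p (X i p) (X j p) = (i == j)%:R.
Proof. by move=> Wp; case: hF => _ _ _ /(_ p Wp) [_ e] _; exact: e. Qed.

Lemma sum_delta k : \sum_(i < k) \sum_(j < k) (1 - (i == j)%:R : R) =
  k%:R * (k%:R - 1).
Proof.
rewrite (eq_bigr (fun=> k%:R - 1)) => [|i _].
  by rewrite sumr_const card_ord mulr_natl.
rewrite sumrB sumr_const card_ord (bigD1 i) //= eqxx big1 ?addr0 //.
by move=> j /negPf; rewrite eq_sym => ->.
Qed.

Lemma vertical_space_form p : W p ->
  \sum_i \sum_j gM p (curv nabla (U j) (U i) (U i) p) (U j p) =
  c / 4 * (r%:R * (r%:R - 1)).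
Proof.
move=> Wp; rewrite -sum_delta mulr_sumr; apply: eq_bigr => i _.
rewrite mulr_sumr; apply: eq_bigr => j _.
rewrite space_form_curvature //; do ?exact: vsmooth_U.
rewrite !frame_UU // !eqxx mulr1 big1.
  by rewrite mulr0 addr0 (eq_sym j); case: (i == j); rewrite ?expr0n ?expr1n.
(* Anti-invariance: J_a of a vertical vector is horizontal, so the J-terms vanish. *)
move=> a _; rewrite metric_hv ?expr0n //; first exact: vertical_U.
by apply: hanti => //; exact: vertical_U.
Qed.

Lemma mixed_space_form p : W p ->
  \sum_i \sum_k gM p (curv nabla (X i) (U k) (U k) p) (X i p) =
  c / 4 * (l%:R * r%:R + 3 * \sum_a \sum_i sqB gM pi U X (J a) i p).
Proof.
move=> Wp.
have -> : \sum_a \sum_i sqB gM pi U X (J a) i p =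
    \sum_i \sum_k \sum_a gM p (J a p (X i p)) (U k p) ^+ 2.
  rewrite exchange_big; apply: eq_bigr => i _ /=.
  by rewrite (eq_bigr _ (fun a _ => (sqB_sqC_frame i Wp a).1)) exchange_big.
have -> : l%:R * r%:R = \sum_(i < l) r%:R :> R.
  by rewrite sumr_const card_ord mulr_natl.
rewrite mulr_sumr -big_split mulr_sumr; apply: eq_bigr => i _ /=.
have -> : r%:R = \sum_(k < r) 1 :> R by rewrite sumr_const card_ord.
rewrite mulr_sumr -big_split mulr_sumr; apply: eq_bigr => k _ /=.
rewrite space_form_curvature //; [|exact: vsmooth_X|exact: vsmooth_U].
rewrite frame_UU // frame_XX // !eqxx mulr1.
by rewrite metric_hv ?expr0n ?subr0 //; [exact: vertical_U|exact: horizontal_X].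
Qed.

(** The fields supplied by [horizontal_curvature] vary with the pair of indices, so O'Neill's
    equation and the space form formula are combined pair by pair, before summing. *)
Lemma horizontal_space_form p : W p ->
  tau_base gM nablaN pi X p + 3 * sqAV gM nabla pi X p =
  c / 4 * (l%:R * (l%:R - 1) + 3 * \sum_a \sum_i sqC gM pi X (J a) i p).
Proof.
move=> Wp.
have -> : \sum_a \sum_i sqC gM pi X (J a) i p =
    \sum_i \sum_j \sum_a gM p (J a p (X i p)) (X j p) ^+ 2.
  rewrite exchange_big; apply: eq_bigr => i _ /=.
  by rewrite (eq_bigr _ (fun a _ => (sqB_sqC_frame i Wp a).2)) exchange_big.
rewrite /tau_base /sqAV -sum_delta !mulr_sumr -!big_split mulr_sumr.
apply: eq_bigr => i _ /=.
rewrite !mulr_sumr -!big_split mulr_sumr; apply: eq_bigr => j _ /=.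
have [hXi hXj] := (horizontal_X i Wp, horizontal_X j Wp).
have [Y [Z [sY sZ nY nZ [Yx Zy RE]]]] := horizontal_curvature Wp hXi hXj.
have := RE; rewrite space_form_curvature // Yx Zy !frame_XX // !eqxx mulr1.
rewrite (@vproj_nabla_eq p (X i p) Z (X j)) //; do ?
  [exact: tangent_X|exact: vsmooth_X|exact: horizontal_near_X].
rewrite oneillA_horizontal //; do ?
  [exact: vsmooth_X|exact: horizontal_near_X].
by move=> <-; case: (i == j); rewrite ?expr0n ?expr1n.
Qed.

(** For r = 0 the inverse defaults to 0, and both sides vanish because the sum is empty. *)
Lemma normal_field_mean_curv p : normal_field gM nabla pi U p = r%:R *: H p.
Proof.
rewrite /mean_curv scalerA; have [r0|r0] := eqVneq (r%:R : R) 0; last first.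
  by rewrite divff // scale1r.
rewrite /normal_field r0 mul0r scale0r; apply: big1 => -[i ir].
by exfalso; move/eqP: r0; rewrite pnatr_eq0 => /eqP r0; move: ir; rewrite r0.
Qed.

(* The defect in the inequality is the squared norm of the traceless second   *)
(* fundamental form of the fibres.                                            *)
Lemma submersion_defect p : W p ->
  submersion_rhs gM nabla nablaN pi U X p =
  submersion_lhs gM pi U X c J p
  + \sum_i \sum_j gM p (T i j p - (i == j)%:R *: H p) (T i j p - (i == j)%:R *: H p).
Proof.
move=> Wp; have tT i j : tangent p (T i j p).
  exact/horizontal_tangent/horizontal_T.
have tH : tangent p (H p) by apply/horizontal_tangent/horizontal_mean_curv.
have tdH i j : tangent p ((i == j :> 'I_r)%:R *: H p) by exact: tangentZ.
have -> : \sum_i \sum_j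
      gM p (T i j p - (i == j)%:R *: H p) (T i j p - (i == j)%:R *: H p) =
    \sum_i \sum_j gM p (T i j p) (T i j p) - r%:R * gM p (H p) (H p).
  (* Since the T_ii add up to rH, the cross terms give 2r|H|^2, from which the r diagonal squares
     |H|^2 are subtracted. *)
  have -> : r%:R * gM p (H p) (H p) =
      \sum_i (2 * gM p (T i i p) (H p) - gM p (H p) (H p)).
    rewrite sumrB sumr_const card_ord -mulr_sumr -(metric_suml hgM) //.
    have -> : \sum_i T i i p = r%:R *: H p := normal_field_mean_curv p.
    by rewrite (metricZl hgM _ tH tH) -mulr_natl; ring.
  rewrite -sumrB; apply: eq_bigr => i _.
  have -> : 2 * gM p (T i i p) (H p) - gM p (H p) (H p) =
      \sum_j (2 * (i == j)%:R * gM p (T i j p) (H p) - (i == j)%:R * gM p (H p) (H p)).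
    rewrite (bigD1 i) //= eqxx big1 ?addr0 ?mulr1 ?mul1r // => j.
    by rewrite eq_sym => /negPf ->; rewrite mulr0 !mul0r subr0.
  rewrite -sumrB; apply: eq_bigr => j _.
  rewrite (metric_sqrB hgM _ (tT i j) tH).
  by case: (i == j) => /=; ring.
have NN : gM p (normal_field gM nabla pi U p) (normal_field gM nabla pi U p) =
    r%:R * (r%:R * gM p (H p) (H p)).
  have trH : tangent p (r%:R *: H p) by exact: tangentZ.
  by rewrite normal_field_mean_curv (metricZl hgM _ tH trH) (metricZr hgM _ tH tH).
have Ev := vertical_curvature_sum Wp; rewrite vertical_space_form // NN in Ev.
have Em := mixed_curvature_sum Wp; rewrite mixed_space_form // in Em.
have Eh := horizontal_space_form Wp.
rewrite /submersion_rhs /submersion_lhs.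
have -> : \sum_a \sum_i (6 * sqB gM pi U X (J a) i p + 3 * sqC gM pi X (J a) i p) =
   6 * \sum_a \sum_i sqB gM pi U X (J a) i p + 3 * \sum_a \sum_i sqC gM pi X (J a) i p.
  rewrite !mulr_sumr -big_split; apply: eq_bigr => a _ /=.
  by rewrite !mulr_sumr -big_split.
move: Ev Em Eh; rewrite natrD.
set tf := tau_fiber _ _ _ _ _; set tb := tau_base _ _ _ _ _.
set av := sqAV _ _ _ _ _; set ah := sqAH _ _ _ _ _ _; set tv := sqTV _ _ _ _ _ _.
set dn := deltaN _ _ _ _ _ _; set b := \sum_a \sum_i sqB _ _ _ _ _ _ _.
set cc := \sum_a \sum_i sqC _ _ _ _ _ _; set s := \sum_i \sum_j gM p (T _ _ _) _.
set h := gM p (H p) (H p); move=> Ev Em Eh.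
have {}Ev : tf = c / 4 * (r%:R * (r%:R - 1)) - r%:R * (r%:R * h) + s.
  by rewrite Ev; ring.
have {}Em : dn = tv - ah - c / 4 * (l%:R * r%:R + 3 * b) by rewrite Em; ring.
have {}Eh : tb = c / 4 * (l%:R * (l%:R - 1) + 3 * cc) - 3 * av.
  by rewrite -Eh; ring.
by rewrite Ev Em Eh; ring.
Qed.

Lemma oneillT_defect_ge0 p i j : W p ->
  0 <= gM p (T i j p - (i == j)%:R *: H p) (T i j p - (i == j)%:R *: H p).
Proof.
move=> Wp; apply: (metric_ge0 hgM); apply: tangentB.
  exact/horizontal_tangent/horizontal_T.
exact/tangentZ/horizontal_tangent/horizontal_mean_curv.
Qed.

Lemma submersion_inequality p : W p ->
  submersion_lhs gM pi U X c J p <= submersion_rhs gM nabla nablaN pi U X p.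
Proof.
move=> Wp; rewrite submersion_defect // lerDl; apply: sumr_ge0 => i _.
by apply: sumr_ge0 => j _; exact: oneillT_defect_ge0.
Qed.

Lemma submersion_equality p : W p ->
  submersion_lhs gM pi U X c J p = submersion_rhs gM nabla nablaN pi U X p <->
  forall i j, T i j p = (i == j)%:R *: H p.
Proof.
move=> Wp; rewrite submersion_defect //; split.
  move=> /eqP; rewrite eq_sym -subr_eq0 addrC addKr => /eqP s0 i j.
  (* A vanishing sum of nonnegative terms vanishes termwise: applied to the outer sum, then to the
     inner one. *)
  have := psumr_eq0P _ s0 => /(_ _ i isT) si.
  have {}si := si (fun i _ => sumr_ge0 _ (fun j _ => oneillT_defect_ge0 i j Wp)).
  have := psumr_eq0P (fun j _ => oneillT_defect_ge0 i j Wp) si => /(_ j isT) d0.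
  apply/eqP; rewrite -subr_eq0; apply/eqP; apply: (metric_eq0 hgM) d0.
  apply: tangentB; first exact/horizontal_tangent/horizontal_T.
  exact/tangentZ/horizontal_tangent/horizontal_mean_curv.
move=> TH; rewrite big1 ?addr0 // => i _; rewrite big1 // => j _.
by rewrite TH subrr (metric0l hgM) //; exact: tangent0.
Qed.

(** Both sides of the umbilicity equation are horizontal and bilinear in the vertical arguments, so
    comparing components along [X i] reduces it to the frame; the frame fields themselves give the
    converse. *)
Lemma umbilical_frame :
  (forall p, W p -> forall i j, T i j p = (i == j)%:R *: H p) <->
  umbilical_fibers_on gM nabla pi U W.
Proof.
split=> [TH W' V Z oW' sW sV sZ vVZ p W'p | hu p Wp i j]; last first.
  rewrite (hu W) //; first by rewrite frame_UU.
  - by case: hF => h _ _ _ _; exact: h.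
  - by case: hF => h _ _ _ _; exact: h.
  - by move=> q Wq; split; exact: vertical_U.
have Wp := sW p W'p; have [vV vZ] := vVZ p W'p.
have sZp := (vsmooth_onP Z oW').1 sZ p W'p.
have nZ : vertical_near p Z by apply: (near_open oW' W'p) => q /vVZ[].
rewrite oneillT_vertical //; have hH := horizontal_mean_curv Wp.
have tV := vertical_tangent vV; have tn := nabla_tangent hD tV sZp.
have hn := hproj_horizontal Wp tn; have hs := horizontalZ (gM p (V p) (Z p)) hH.
rewrite (horizontal_expand Wp hn) [RHS](horizontal_expand Wp hs).
apply: eq_bigr => i _; congr (_ *: _).
have hX := horizontal_X i Wp.
have [tX tH] := (horizontal_tangent hX, horizontal_tangent hH).
have tU k := tangent_U k Wp.
rewrite -metric_hproj // metric_nabla_vertical // (metricZl hgM) //.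
rewrite {2}(vertical_expand Wp vV) (metric_suml hgM); last 2 first.
- by move=> k; exact: tangentZ.
- exact: vertical_tangent.
rewrite mulr_suml; apply: eq_bigr => k _; rewrite (metricZl hgM) //; last first.
  exact: vertical_tangent.
rewrite (bigD1 k) //= big1 ?addr0 => [|h hk]; rewrite TH // (metricZl hgM) //.
  by rewrite eqxx mul1r (metricC hgM (vertical_tangent vZ) (tU k)).
by rewrite eq_sym (negPf hk) mul0r mulr0.
Qed.

End SpaceForm.

End Submersion.

(** Adapted frames and quaternionic bases are only local, so they are given over an open cover
    indexed by [I]; equality on every patch is then equality at all points of [M], and each patch is
    treated separately. *)
Theorem theorem3p14 (R : realType) (m n r l : nat) (c : R)
  (M : manifold R (4 * m)%N) (N : manifold R n)
  (gM : M -> tvec M -> tvec M -> R) (nabla : M -> tvec M -> vfield M -> tvec M)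
  (E : M -> set (tvec M -> tvec M))
  (gN : N -> tvec N -> tvec N -> R) (nablaN : N -> tvec N -> vfield N -> tvec N)
  (pi : M -> N)
  (hnabla : levi_civita gM nabla)
  (hM : quaternionic_space_form gM nabla E c)
  (hN : riemannian_metric gN)
  (hnablaN : levi_civita gN nablaN)
  (hpi : riemannian_submersion gM gN pi)
  (hanti : anti_invariant gM pi E)
  (I : Type) (W : I -> set M) (J : I -> 'Z_3 -> M -> tvec M -> tvec M)
  (U : I -> 'I_r -> vfield M) (X : I -> 'I_l -> vfield M)
  (hW : forall k, open (W k))
  (hcover : forall p, exists k, W k p)
  (hJ : forall k, quaternionic_basis gM E (W k) (J k))
  (hframe : forall k, adapted_frame gM pi (U k) (X k) (W k)) :
  (forall k p, W k p ->
     submersion_lhs gM pi (U k) (X k) c (J k) p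
     <= submersion_rhs gM nabla nablaN pi (U k) (X k) p)
  /\
  ((forall k p, W k p ->
      submersion_lhs gM pi (U k) (X k) c (J k) p
      = submersion_rhs gM nabla nablaN pi (U k) (X k) p)
   <->
   (riemannian_submersion gM gN pi /\
    (forall k, umbilical_fibers_on gM nabla pi (U k) (W k))) /\
   (forall k p, W k p -> forall i j : 'I_r, i != j ->
      oneillT gM nabla pi (U k i) (U k j) p = 0)).
Proof.
have [[[hg _] _] hc] := hM.
have hcurv k := hc _ _ (hW k) (hJ k).
have hJv k := hanti _ _ (hW k) (hJ k).
have ineq k p (Wp : W k p) := submersion_inequality hg hN hnabla hnablaN hpi
  (hW k) (hframe k) (hJ k) (hJv k) (hcurv k) Wp.
have eqlt k p (Wp : W k p) := submersion_equality hg hN hnabla hnablaN hpi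
  (hW k) (hframe k) (hJ k) (hJv k) (hcurv k) Wp.
have umb k := umbilical_frame hg hnabla (hW k) (hframe k).
split=> //; split=> [eqn|[[_ hu] _] k p Wp].
  have TH k p (Wp : W k p) := (eqlt k p Wp).1 (eqn k p Wp).
  split; first by split=> // k; apply/umb; exact: TH.
  by move=> k p Wp i j ij; rewrite TH // (negPf ij) scale0r.
by apply/(eqlt k p Wp); exact: (umb k).2 (hu k) p Wp.
Qed.
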